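(* Let $(M,F)$ be a Finsler structure with Chern connection $\nabla^{ch}$, and let $\langle\nabla^{ch}\rangle$ be its averaged connection. Then $(M,F)$ is a Berwald structure if and only if $\pi^*\langle\nabla^{ch}\rangle=\nabla^{ch}$.
   Context: Finsler structure: $M$ is a smooth $n$-manifold, $N=TM\setminus\{0\}$, $\pi:N\to M$; $F:TM\to[0,\infty)$ is smooth on $N$, satisfies $F(x,\lambda y)=\lambda F(x,y)$ for $\lambda>0$, and $g_{ij}(x,y)=\frac12\frac{\partial^2F^2}{\partial y^i\partial y^j}$ is positive definite on $N$. Put $A_{ijk}=\frac F2\frac{\partial g_{ij}}{\partial y^k}$, $\gamma^i_{jk}=\frac12 g^{is}(\partial_{x^k}g_{sj}-\partial_{x^s}g_{jk}+\partial_{x^j}g_{sk})$, $N^i_j=\gamma^i_{jk}y^k-\frac1F A^i_{jk}\gamma^k_{rs}y^ry^s$ (indices are raised with $g^{ij}$), $\frac{\delta}{\delta x^j}=\frac{\partial}{\partial x^j}-N^i_j\frac{\partial}{\partial y^i}$, $\delta y^i=dy^i+N^i_jdx^j$. For $X=X^i\partial_{x^i}\in T_xM$ and $u\in\pi^{-1}(x)$ the horizontal lift is $\iota_u(X)=X^i\frac{\delta}{\delta x^i}|_u$. Chern connection: $\pi^*TM\to N$ is the pull-back bundle, whose fibre over $u$ is $\{u\}\times T_{\pi(u)}M$; $\pi_2|_u$ is the projection of this fibre onto $T_{\pi(u)}M$, and $\pi^*Y$ is the section $u\mapsto(u,Y(\pi(u)))$. The Chern connection $\nabla^{ch}$ is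 the unique linear connection on $\pi^*TM$ with connection forms $\omega^i_j=\Gamma^i_{jk}(x,y)dx^k$, $\Gamma^i_{jk}=\Gamma^i_{kj}$, and $dg_{ij}-g_{kj}\omega^k_i-g_{ik}\omega^k_j=2A_{ijk}\frac{\delta y^k}{F}$. $(M,F)$ is Berwald if the coefficients $\Gamma^i_{jk}$ of the Chern connection in natural coordinates do not depend on $y$. Averaged connection: with $I_x=\{y\in T_xM: F(x,y)=1\}$ and $dvol$ the volume form induced on $I_x$ by the Riemannian metric $g_{ij}(x,y)dy^i\otimes dy^j$ on $T_xM\setminus\{0\}$, $\langle\nabla^{ch}\rangle$ is the affine connection on $M$ given by $\langle\nabla^{ch}\rangle_XY=\frac{1}{vol(I_x)}\int_{I_x}\pi_2|_u\big(\nabla^{ch}_{\iota_u(X)}\pi^*Y\big)\,dvol(u)$. Pull-back connection: for an affine connection $D$ on $M$, $\pi^*D$ is the linear connection on $\pi^*TM\to N$ with $(\pi^*D)_{\iota(X)}\pi^*S=\pi^*(D_XS)$ for vector fields $X,S$ on $M$, and $(\pi^*D)_{V}\pi^*S=0$ for vertical $V$. *)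

(* Defs.v *)
From HB Require Import structures.
From mathcomp Require Import all_boot all_order all_algebra.
From mathcomp Require Import all_classical all_reals all_analysis.
Import Order.TTheory GRing.Theory Num.Theory.
Import numFieldNormedType.Exports.

Set Implicit Arguments.
Unset Strict Implicit.
Unset Printing Implicit Defensive.

Local Open Scope classical_set_scope.
Local Open Scope ring_scope.

Section Smoothness.
Context {R : realType} {V W : normedModType R}.

(* For V finite-dimensional and A open this is the usual class C^k(A). *)
Fixpoint Ck_on (k : nat) (A : set V) (f : V -> W) : Prop :=
  match k with
  | 0 => forall x, A x -> {for x, continuous f}
  | k'.+1 => (forall x, A x -> differentiable f x) /\
             (forall v : V, Ck_on k' A ('D_v f))
  end.

Definition smooth_on (A : set V) (f : V -> W) : Prop := forall k, Ck_on k A f.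

Definition smooth_near (f : V -> W) (x : V) : Prop :=
  exists A : set V, [/\ open A, A x & smooth_on A f].

End Smoothness.

Section Charts.
Context {R : realType} {n : nat} {T : topologicalType}.

(* cmap is only meaningful on cdom, cinv on the image of cdom. *)
Record chart := Chart {
  cdom : set T;
  cmap : T -> 'rV[R]_n;
  cinv : 'rV[R]_n -> T;
  cdom_open : open cdom;
  cimage_open : open (cmap @` cdom);
  cmapK : forall p, cdom p -> cinv (cmap p) = p;
  cmap_continuous : forall p, cdom p -> {for p, continuous cmap};
  cinv_continuous : forall x, (cmap @` cdom) x -> {for x, continuous cinv} }.

Definition transition (c c' : chart) : 'rV[R]_n -> 'rV[R]_n :=
  cmap c' \o cinv c.

Definition smoothly_compatible (c c' : chart) : Prop :=
  smooth_on (cmap c @` (cdom c `&` cdom c')) (transition c c') /\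
  smooth_on (cmap c' @` (cdom c' `&` cdom c)) (transition c' c).

(* The map induced by a change of coordinates on (position, velocity) pairs. *)
Definition tangent_transition (c c' : chart) (z : 'rV[R]_n * 'rV[R]_n) :
    'rV[R]_n * 'rV[R]_n :=
  (transition c c' z.1, 'd (transition c c') (z.1) (z.2)).

End Charts.
Arguments chart R n T : clear implicits.

(* chart_at selects a preferred chart around each point; it only serves to
   represent tangent vectors, see below. *)
Record manifold (R : realType) (n : nat) := Manifold {
  carrier :> topologicalType;
  manifold_hausdorff : hausdorff_space carrier;
  manifold_second_countable : @second_countable carrier;
  atlas : set (chart R n carrier);
  atlas_compatible : forall c c', atlas c -> atlas c' ->
    smoothly_compatible c c';
  atlas_maximal : forall c, (forall c', atlas c' -> smoothly_compatible c c') ->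
    atlas c;
  chart_at : carrier -> chart R n carrier;
  chart_at_atlas : forall p, atlas (chart_at p);
  chart_at_dom : forall p, cdom (chart_at p) p }.

Section TangentBundle.
Context {R : realType} {n : nat} (M : manifold R n).
Local Notation E := 'rV[R]_n.

(* T_pM: a tangent vector is represented by its components in the natural
   coordinates of chart_at p.  The components in any other chart are
   obtained by tan_coord; tan_vec is the inverse operation. *)
Definition tangent (p : M) : Type := E.

Definition tan_coord (c : chart R n M) (p : M) (v : tangent p) : E :=
  'd (transition (chart_at p) c) (cmap (chart_at p) p) v.

Definition tan_vec (c : chart R n M) (p : M) (a : E) : tangent p :=
  'd (transition c (chart_at p)) (cmap c p) a.

Record TM := Tvec { base : M; fib : tangent base }.

(* The manifold N = TM \ 0 is the subset slit of TM. *)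
Definition slit (u : TM) : Prop := fib u != 0 :> E.

(* Natural coordinates (x, y) on TM induced by a chart, and their inverse. *)
Definition Tcoord (c : chart R n M) (u : TM) : E * E :=
  (cmap c (base u), tan_coord c (fib u)).

Definition Tpoint (c : chart R n M) (z : E * E) : TM :=
  Tvec (tan_vec c (cinv c z.1) z.2).

(* T_uTM: the vector a^k d/dx^k + b^k d/dy^k, with (x, y) the natural
   coordinates of chart_at (base u), is represented by (a, b). *)
Definition dtangent (u : TM) : Type := (E * E)%type.

Definition dtan_coord (c : chart R n M) (u : TM) (V : dtangent u) : E * E :=
  'd (tangent_transition (chart_at (base u)) c) (Tcoord (chart_at (base u)) u) V.

Definition dtan_vec (c : chart R n M) (u : TM) (w : E * E) : dtangent u :=
  'd (tangent_transition c (chart_at (base u))) (Tcoord c u) w.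

(* In natural coordinates the differential of TM -> M is (a, b) |-> a. *)
Definition vertical (u : TM) (V : dtangent u) : Prop := V.1 = 0 :> E.

(* Functions, vector fields and sections are total but only required to be
   smooth near the point under consideration, i.e. local ones are allowed. *)
Definition vfield := forall p : M, tangent p.
Definition section := forall u : TM, tangent (base u).
Definition TMfield := forall u : TM, dtangent u.

Definition pullback_vfield (Y : vfield) : section := fun u => Y (base u).

Definition local_fun (c : chart R n M) (f : TM -> R) : E * E -> R :=
  f \o Tpoint c.
Definition local_vfield (c : chart R n M) (Y : vfield) (x : E) : E :=
  tan_coord c (Y (cinv c x)).
Definition local_section (c : chart R n M) (S : section) (z : E * E) : E :=
  tan_coord c (S (Tpoint c z)).
Definition local_TMfield (c : chart R n M) (V : TMfield) (z : E * E) : E * E :=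
  dtan_coord c (V (Tpoint c z)).

(* "In some chart" is the same as "in every chart" around the point. *)
Definition smooth_fun_at (f : TM -> R) (u : TM) : Prop :=
  exists c, [/\ atlas c, cdom c (base u) &
    smooth_near (local_fun c f) (Tcoord c u)].
Definition smooth_vfield_at (Y : vfield) (p : M) : Prop :=
  exists c, [/\ atlas c, cdom c p & smooth_near (local_vfield c Y) (cmap c p)].
Definition smooth_section_at (S : section) (u : TM) : Prop :=
  exists c, [/\ atlas c, cdom c (base u) &
    smooth_near (local_section c S) (Tcoord c u)].
Definition smooth_TMfield_at (V : TMfield) (u : TM) : Prop :=
  exists c, [/\ atlas c, cdom c (base u) &
    smooth_near (local_TMfield c V) (Tcoord c u)].

Definition deriv_fun (u : TM) (V : dtangent u) (f : TM -> R) : R :=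
  'D_(V : E * E) (local_fun (chart_at (base u)) f)
    (Tcoord (chart_at (base u)) u).

Record connection := Connection {
  nabla :> forall u : TM, dtangent u -> section -> tangent (base u);
  nabla_linear : forall u S (a : R) (V W : dtangent u),
    slit u -> smooth_section_at S u ->
    nabla (a *: (V : E * E) + W : dtangent u) S
      = a *: (nabla V S : E) + nabla W S :> E;
  nablaD : forall u S S' (V : dtangent u),
    slit u -> smooth_section_at S u -> smooth_section_at S' u ->
    nabla V (fun w => (S w : E) + S' w) = (nabla V S : E) + nabla V S' :> E;
  nabla_leibniz : forall u f S (V : dtangent u),
    slit u -> smooth_fun_at f u -> smooth_section_at S u ->
    nabla V (fun w => f w *: (S w : E))
      = deriv_fun V f *: (S u : E) + f u *: (nabla V S : E) :> E;
  nabla_smooth : forall u S (V : TMfield),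
    slit u -> smooth_TMfield_at V u -> smooth_section_at S u ->
    smooth_section_at (fun w => nabla (V w) S) u }.

(* Equality of connections; values on non-smooth sections are junk. *)
Definition connection_eq (D D' : connection) : Prop :=
  forall u (V : dtangent u) S, slit u -> smooth_section_at S u ->
    D u V S = D' u V S.

(* The local vector field d/dx^j of the chart c. *)
Definition coord_vfield (c : chart R n M) (j : 'I_n) : vfield :=
  fun p => tan_vec c p (delta_mx 0 j).

(* omega^i_j(V), the connection forms in the frame pi^*(d/dx^j). *)
Definition conn_form (D : connection) (c : chart R n M) (i j : 'I_n)
    (u : TM) (V : dtangent u) : R :=
  tan_coord c (D u V (pullback_vfield (coord_vfield c j))) 0 i.

(* Gamma^i_jk = omega^i_j(d/dx^k) *)
Definition conn_coef (D : connection) (c : chart R n M) (u : TM)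
    (i j k : 'I_n) : R :=
  conn_form D c i j (dtan_vec c u (delta_mx 0 k, 0)).

End TangentBundle.

Section LocalTensors.
Context {R : realType} {n : nat}.
Local Notation E := 'rV[R]_n.
Variable L : E * E -> R. (* F in natural coordinates *)

Definition dx (k : 'I_n) : E * E := (delta_mx 0 k, 0).
Definition dy (k : 'I_n) : E * E := (0, delta_mx 0 k).

Definition fund (z : E * E) : 'M[R]_n :=
  \matrix_(i, j) (2^-1 * 'D_(dy i) ('D_(dy j) (fun w => L w ^+ 2)) z).

Definition cartan (z : E * E) (i j k : 'I_n) : R :=
  L z / 2 * 'D_(dy k) (fun w => fund w i j) z.

Definition cartan_up (z : E * E) (i j k : 'I_n) : R :=
  \sum_s invmx (fund z) i s * cartan z s j k.

Definition christoffel (z : E * E) (i j k : 'I_n) : R :=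
  2^-1 * \sum_s invmx (fund z) i s *
    ('D_(dx k) (fun w => fund w s j) z - 'D_(dx s) (fun w => fund w j k) z
     + 'D_(dx j) (fun w => fund w s k) z).

Definition nonlinear_coef (z : E * E) (i j : 'I_n) : R :=
  \sum_k christoffel z i j k * z.2 0 k -
  (L z)^-1 * \sum_k \sum_r \sum_s
    cartan_up z i j k * christoffel z k r s * z.2 0 r * z.2 0 s.

End LocalTensors.

(* Lebesgue integral over R^m, as an iterated integral; used below on
   nonnegative functions only. *)
Fixpoint integral_rV {R : realType} (m : nat) : ('rV[R]_m -> \bar R) -> \bar R :=
  match m with
  | 0 => fun f => f 0
  | m'.+1 => fun f : 'rV[R]_(1 + m') -> \bar R =>
      (\int[@lebesgue_measure R]_t
         integral_rV (fun v : 'rV[R]_m' => f (row_mx (t%:M : 'M[R]_1) v)))%E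
  end.

Section Finsler.
Context {R : realType} {n : nat} {M : manifold R n}.
Local Notation E := 'rV[R]_n.

Record finsler := Finsler {
  finsler_fun :> TM M -> R;
  finsler_ge0 : forall u, 0 <= finsler_fun u;
  finsler_smooth : forall u, slit u -> smooth_fun_at finsler_fun u;
  finsler_homo : forall (p : M) (y : tangent p) (l : R), 0 < l ->
    finsler_fun (Tvec (l *: (y : E) : tangent p)) = l * finsler_fun (Tvec y);
  finsler_posdef : forall c u, atlas c -> cdom c (base u) -> slit u ->
    forall v : E, v != 0 ->
    0 < (v *m fund (local_fun c finsler_fun) (Tcoord c u) *m v^T) 0 0 }.

Variable F : finsler.

(* iota_u(X) = X^i (d/dx^i - N^j_i d/dy^j) *)
Definition hlift (u : TM M) (X : tangent (base u)) : dtangent u :=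
  let c := chart_at (base u) in
  ((X : E), \row_i - \sum_j nonlinear_coef (local_fun c F) (Tcoord c u) i j
                           * (X : E) 0 j).

(* The third clause evaluates both sides of
     dg_ij - g_kj omega^k_i - g_ik omega^k_j = 2 A_ijk delta y^k / F
   on the tangent vector w = w.1^k d/dx^k + w.2^k d/dy^k of TM at u. *)
Definition is_chern (D : connection M) : Prop :=
  forall (c : chart R n M) (u : TM M),
    atlas c -> cdom c (base u) -> slit u ->
    let z := Tcoord c u in
    let L := local_fun c F in
    [/\ forall i j (w : E * E),
          conn_form D c i j (dtan_vec c u w)
            = \sum_k conn_coef D c u i j k * w.1 0 k,
        forall i j k, conn_coef D c u i j k = conn_coef D c u i k j &
        forall i j (w : E * E),
          'D_w (fun z' => fund L z' i j) z
          - \sum_k fund L z k j * conn_form D c k i (dtan_vec c u w)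
          - \sum_k fund L z i k * conn_form D c k j (dtan_vec c u w)
          = 2 * \sum_k cartan L z i j k *
              (w.2 0 k + \sum_l nonlinear_coef L z k l * w.1 0 l) / F u].

Definition berwald : Prop :=
  forall D : connection M, is_chern D ->
  forall (c : chart R n M) (p : M) (y y' : tangent p),
    atlas c -> cdom c p -> slit (Tvec y) -> slit (Tvec y') ->
    forall i j k, conn_coef D c (Tvec y) i j k = conn_coef D c (Tvec y') i j k.

Definition indicatrix (p : M) : set E :=
  [set y | F (Tvec (y : tangent p)) = 1].

(* The Riemannian metric g_ij(p, y) dy^i dy^j on T_pM \ 0. *)
Definition fibre_metric (p : M) (y : E) : 'M[R]_n :=
  let c := chart_at p in
  fund (local_fun c F) (Tcoord c (Tvec (y : tangent p))).

(* Regular parametrization of a piece of the indicatrix; the indicatrix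
   being a hypersurface, its image is relatively open. *)
Definition regular_patch (p : M) (U : set 'rV[R]_n.-1)
    (phi : 'rV[R]_n.-1 -> E) : Prop :=
  [/\ open U, smooth_on U phi,
      (forall s t, U s -> U t -> phi s = phi t -> s = t),
      (forall t, U t -> forall w, 'd phi t w = 0 -> w = 0) &
      phi @` U `<=` indicatrix p].

Definition gram (p : M) (phi : 'rV[R]_n.-1 -> E) (t : 'rV[R]_n.-1) :
    'M[R]_n.-1 :=
  \matrix_(a, b) ('D_(delta_mx 0 a) phi t *m fibre_metric p (phi t)
                  *m ('D_(delta_mx 0 b) phi t)^T) 0 0.

Definition borel_rV := g_sigma_algebraType (@open E).

(* mu is the Riemannian volume dvol of the indicatrix: in each regular
   parametrization its density is sqrt (det (induced metric)). *)
Definition is_indicatrix_volume (p : M)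
    (mu : {measure set borel_rV -> \bar R}) : Prop :=
  mu (~` indicatrix p) = 0%E /\
  forall U phi, regular_patch p U phi ->
    mu (phi @` U) =
    integral_rV (fun t => (\1_U t * Num.sqrt (\det (gram p phi t)))%:E).

(* An operator (X, Y) |-> D_X Y, for X in T_pM and Y a vector field. *)
Definition affine_op := forall p : M, tangent p -> vfield M -> tangent p.

(* The T_pM-valued integral is taken componentwise. *)
Definition averaged (mu : M -> {measure set borel_rV -> \bar R})
    (D : connection M) : affine_op :=
  fun p X Y =>
    (fine (mu p (indicatrix p)))^-1 *:
    \row_i (\int[mu p]_(y in indicatrix p)
      (D (Tvec (y : tangent p)) (@hlift (Tvec (y : tangent p)) X)
         (pullback_vfield Y) : E) 0 i)%R.

Definition is_pullback (A : affine_op) (P : connection M) : Prop :=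
  (forall u (X : tangent (base u)) (S : vfield M),
     slit u -> smooth_vfield_at S (base u) ->
     P u (hlift X) (pullback_vfield S) = A (base u) X S) /\
  (forall u (V : dtangent u) (S : vfield M),
     slit u -> smooth_vfield_at S (base u) -> vertical V ->
     P u V (pullback_vfield S) = 0 :> E).

End Finsler.
Arguments finsler {R n} M.

(* Main.v *)
Require Import Defs.
From HB Require Import structures.
From mathcomp Require Import all_boot all_order all_algebra.
From mathcomp Require Import all_classical all_reals all_analysis.
From mathcomp Require Import measurable_realfun lra ring.
Import Order.TTheory GRing.Theory Num.Theory.
Import numFieldNormedType.Exports.
Local Open Scope classical_set_scope.
Local Open Scope ring_scope.

Set Implicit Arguments.
Unset Strict Implicit.
Unset Printing Implicit Defensive.

(** The Chern connection differentiates a pulled-back field pi^*Y only in the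
    direction of the base: by the first Chern axiom the connection forms see
    only the dx-components of a tangent vector of TM (chern_frame).  So in a
    natural frame its value at a vector over X in T_pM is
    Gamma^i_jk(p, y) X^k, and the only possible dependence on y lies in the
    coefficients.

    If the metric is Berwald, the integrand that defines the averaged
    connection is therefore constant on the indicatrix I_p, and the average of
    a constant is that constant, provided that 0 < vol(I_p) < oo
    (averaged_const, berwald_averaged_frame).  Hence both connections agree on
    the fields pi^*(d/dx^j).  Every section smooth near u is near u a
    combination of these with smooth coefficients, so the Leibniz rule carries
    the equality to all sections (connection_eq_frame).

    Conversely, a pulled-back connection evaluated on pi^*Y depends only on the
    point of M and on the horizontal direction (pullback_frame); if it is the
    Chern connection, the Chern coefficients do not depend on y.  The Berwald
    condition quantifies over all connections that satisfy the Chern axioms,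
    so this direction also uses that the axioms determine the coefficients
    (chern_coef_unique), by the permutation argument that proves uniqueness of
    the Levi-Civita connection.

    The analytic content is the bound 0 < vol(I_p) < oo (indicatrix_volume).
    On one tangent space F restricts to a positively homogeneous function l,
    smooth off 0, with positive definite fundamental tensor; this forces l > 0
    off 0 (minkowski_norm_gt0).  The 2n open cubes of half-width 2 in the
    hyperplanes y_i = 1 and y_i = -1 project radially onto relatively open
    pieces that cover I_p, and the projection is the regular parametrization
    y |-> y / l(y) (radial_immersion, radial_image).  Its Gram determinant is
    continuous and positive on the closed cube, hence bounded above and away
    from 0, so each piece has positive finite volume
    (radial_volume_bounds). *)

(** * Functions of class C^k *)

Section Calculus.
Context {R : realType}.
Implicit Types (U V W : normedModType R).

Lemma near_eq_differentiable V W (f g : V -> W) x :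
  (\near x, f x = g x) -> differentiable f x -> differentiable g x.
Proof.
move=> fg df.
(* the expansion of f at x is also one of g; diff_unique then names 'd g x *)
have key : g \o shift x = cst (g x) + 'd f x +o_ 0 id.
  apply/eqaddoP => _/posnumP[e].
  have /eqaddoP/(_ _ (gt0 e)) := diff_locally df.
  have fg0 : \forall h \near 0, f (h + x) = g (h + x).
    by move: fg; rewrite (near_shift 0) subr0.
  move=> H; near=> h.
  have -> : (g \o shift x - (cst (g x) + 'd f x)) h =
            (f \o shift x - (cst (f x) + 'd f x)) h.
    rewrite !fctE /= (nbhs_singleton fg); congr (_ - _).
    by apply/esym; near: h.
  by near: h.
have dc : continuous ('d f x) by exact: diff_continuous.
have E := diff_unique dc key.
by apply/diff_locallyP; split; rewrite E.
Unshelve. all: by end_near. Qed.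

Lemma near_eq_diff V W (f g : V -> W) x :
  (\near x, f x = g x) -> differentiable f x -> 'd f x = 'd g x :> (V -> W).
Proof.
move=> fg df; apply/funext => v.
rewrite -!deriveE//; first exact: near_eq_derive.
exact: near_eq_differentiable df.
Qed.

Lemma near_eq_on_open V W (A : set V) (f g : V -> W) x : open A -> A x ->
  (forall y, A y -> f y = g y) -> \near x, f x = g x.
Proof. by move=> oA Ax fg; apply: filterS fg _; exact: open_nbhs_nbhs. Qed.

Lemma Ck_on_continuous k V W (A : set V) (f : V -> W) :
  Ck_on k A f -> forall x, A x -> {for x, continuous f}.
Proof.
case: k => [//|k] [df _] x Ax; apply: differentiable_continuous; exact: df.
Qed.

Lemma Ck_on_pred k V W (A : set V) (f : V -> W) : Ck_on k.+1 A f -> Ck_on k A f.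
Proof.
elim: k f => [|k IH] f /= H; first exact: (@Ck_on_continuous 1 _ _ _ _ H).
by case: H => df H; split => // v; apply: IH; exact: H.
Qed.

Lemma Ck_on_sub k V W (A B : set V) (f : V -> W) :
  B `<=` A -> Ck_on k A f -> Ck_on k B f.
Proof.
move=> BA; elim: k f => [|k IH] f /= H; first by move=> x /BA/H.
by case: H => df H; split=> [x /BA/df//|v]; apply: IH; exact: H.
Qed.

Lemma Ck_on_eq k V W (A : set V) (f g : V -> W) : open A ->
  (forall x, A x -> f x = g x) -> Ck_on k A f -> Ck_on k A g.
Proof.
move=> oA; elim: k f g => [|k IH] f g fg /= H.
  move=> x Ax; have nfg := near_eq_on_open oA Ax fg.
  rewrite /prop_for /continuous_at -(fg _ Ax).
  apply: cvg_trans (H _ Ax); exact: near_eq_cvg.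
case: H => df H; split=> [x Ax|v].
  exact: near_eq_differentiable (near_eq_on_open oA Ax fg) (df _ Ax).
apply: (IH ('D_v f)); last exact: H.
by move=> x Ax; apply: near_eq_derive; exact: near_eq_on_open fg.
Qed.

Lemma Ck_on_cst k V W (A : set V) (a : W) : Ck_on k A (fun=> a).
Proof.
elim: k a => [|k IH] a /=; first by move=> x _; exact: cvg_cst.
split=> [x _|v]; first exact: differentiable_cst.
have -> : 'D_v (fun=> a : W) = fun=> (0 : W).
  by apply/funext => x; exact: derive_cst.
exact: IH.
Qed.

Lemma Ck_on_affine k V W (A : set V) (f : {linear V -> W}) (a : W) :
  continuous f -> Ck_on k A (fun x => f x + a).
Proof.
move=> cf; have df x : differentiable (fun x => f x + a) x.
  by apply: (@differentiableD _ _ _ f (cst a)) => //; exact: linear_differentiable.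
case: k => [|k] /=; first by move=> x _; exact: differentiable_continuous.
split=> [//|v].
have -> : 'D_v (fun x => f x + a) = fun=> f v; last exact: Ck_on_cst.
apply/funext => x; rewrite deriveE//.
rewrite (_ : (fun x => f x + a) = (f : V -> W) + cst a)//.
rewrite diffD//=; last exact: linear_differentiable.
by rewrite diff_cst diff_lin //= addr0.
Qed.

Lemma Ck_onD k V W (A : set V) (f g : V -> W) : open A ->
  Ck_on k A f -> Ck_on k A g -> Ck_on k A (fun x => f x + g x).
Proof.
move=> oA; elim: k f g => [|k IH] f g /= Hf Hg.
  by move=> x Ax; apply: cvgD; [exact: Hf|exact: Hg].
case: Hf => df Hf; case: Hg => dg Hg; split=> [x Ax|v].
  by apply: (@differentiableD _ _ _ f g); [exact: df|exact: dg].
apply: Ck_on_eq (IH _ _ (Hf v) (Hg v)) => // x Ax.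
by rewrite -deriveD//; apply: diff_derivable; [exact: df|exact: dg].
Qed.

Lemma Ck_onM k V (A : set V) (f g : V -> R) : open A ->
  Ck_on k A f -> Ck_on k A g -> Ck_on k A (fun x => f x * g x).
Proof.
move=> oA; elim: k f g => [|k IH] f g Hf Hg.
  by move=> x Ax; apply: cvgM; [exact: Hf|exact: Hg].
move: (Hf) (Hg) => /Ck_on_pred Hf0 /Ck_on_pred Hg0.
case: Hf => df Hf; case: Hg => dg Hg; split=> [x Ax|v].
  by apply: (@differentiableM _ _ f g); [exact: df|exact: dg].
apply: Ck_on_eq (Ck_onD oA (IH _ _ Hf0 (Hg v)) (IH _ _ Hg0 (Hf v))) => // x Ax.
have := @deriveM _ _ f g x v; rewrite /= => ->//; apply: diff_derivable;
  by [exact: df|exact: dg].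
Qed.

Lemma Ck_onV k V (A : set V) (f : V -> R) : open A ->
  (forall x, A x -> f x != 0) -> Ck_on k A f -> Ck_on k A (fun x => (f x)^-1).
Proof.
move=> oA f0; elim: k => [|k IH] Hf.
  by move=> x Ax; apply: cvgV; [exact: f0|exact: Hf].
have /IH If := Ck_on_pred Hf.
case: Hf => df Hf; split=> [x Ax|v].
  by apply: differentiableV; [exact: df|exact: f0].
have CN := Ck_onM oA (@Ck_on_cst k _ _ A (-1 : R)) (Ck_onM oA If If).
apply: Ck_on_eq (Ck_onM oA CN (Hf v)) => // x Ax.
rewrite deriveV; [|exact: f0|by apply: diff_derivable; exact: df].
by rewrite mulN1r -invfM -expr2.
Qed.

(** A directional derivative of f \o (l + a) along v is the derivative of f
    along l v composed with the same affine map, so the induction on k closes. *)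
Lemma Ck_on_comp_affine k U V W (A : set V) (f : V -> W) (l : {linear U -> V})
  (a : V) : continuous l -> Ck_on k A f ->
  Ck_on k [set x | A (l x + a)] (fun x => f (l x + a)).
Proof.
move=> cl.
have dl x : differentiable (fun x => l x + a) x.
  by apply: (@differentiableD _ _ _ l (cst a)) => //; exact: linear_differentiable.
elim: k f => [|k IH] f /= H.
  move=> x /= Ax; apply: continuous_comp; last exact: H.
  exact: differentiable_continuous.
case: H => df H; split=> [x /= Ax|v].
  by apply: (@differentiable_comp _ _ _ _ (fun x => l x + a) f) => //; exact: df.
rewrite (_ : 'D_v _ = fun x => 'D_(l v) f (l x + a)).
  exact: (IH ('D_(l v) f) (H (l v))).
apply/funext => x; rewrite /derive; set g := fun h : R => _; set g' := fun h : R => _.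
suff -> : g = g' by [].
by apply/funext => h; rewrite /g /g' /= (linearD l) (linearZZ l) addrA.
Qed.

Lemma Ck_on_coord k V m n (A : set V) (f : V -> 'M[R]_(m, n)) i j : open A ->
  Ck_on k A f -> Ck_on k A (fun x => f x i j).
Proof.
move=> oA; elim: k f => [|k IH] f /= H.
  move=> x Ax; apply: (@continuous_comp _ _ _ f (fun M : 'M[R]_(m, n) => M i j)).
    exact: H.
  exact: coord_continuous.
case: H => df H; split=> [x Ax|v].
  apply: (@differentiable_comp _ _ _ _ f (fun M => M i j : R)); first exact: df.
  exact: differentiable_coord.
apply: Ck_on_eq (IH _ (H v)) => // x Ax.
by rewrite derive_mx ?mxE//; apply: diff_derivable; exact: df.
Qed.

Lemma differentiable_rV V n (f : V -> 'rV[R]_n) x :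
  (forall j, differentiable (fun x => f x 0 j) x) -> differentiable f x.
Proof.
move=> H.
have -> : f = \sum_j (fun x => f x 0 j *: (delta_mx 0 j : 'rV[R]_n)).
  by apply/funext => y; rewrite fct_sumE [LHS]row_sum_delta.
by apply: differentiable_sum => j; exact: differentiableZl.
Qed.

(** Smoothness of a row vector is checked entry by entry, which reduces the
    calculus of vector-valued maps to sums and products of real functions. *)
Lemma Ck_on_rV k V n (A : set V) (f : V -> 'rV[R]_n) : open A ->
  (forall j, Ck_on k A (fun x => f x 0 j)) -> Ck_on k A f.
Proof.
move=> oA; elim: k f => [|k IH] f /= H.
  move=> x Ax; apply/(cvg_mx_entourageP _ _) => E entE.
  near=> y => i j; rewrite ord1; move: j; near: y.
  apply: filter_forall => j.
  have /cvg_entourageP/(_ _ entE) Hj := H j x Ax.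
  have {}Hj : \forall z \near x, E (f x 0 j, f z 0 j) by [].
  suff : \forall z \near x, (f x 0 j, f z 0 j) \in E by [].
  by move: Hj; apply: filterS => z; rewrite inE.
split=> [x Ax|v].
  by apply: differentiable_rV => j; case: (H j) => dj _; exact: dj.
apply: IH => j; case: (H j) => dj /(_ v) Hj.
apply: Ck_on_eq Hj => // x Ax.
rewrite derive_mx ?mxE//; apply: diff_derivable; apply: differentiable_rV => i.
by case: (H i) => di _; exact: di.
Unshelve. all: by end_near. Qed.

End Calculus.

(** * Iterated integrals of bounded functions on a cube *)

Section IteratedIntegral.
Context {R : realType}.

(** The integral of a nonnegative function is a supremum over the simple
    functions below it, so it is monotone even when measurability is unknown,
    as it is for the inner integrals of an iterated integral. *)
Lemma nneg_le_integral d (T : measurableType d)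
    (mu : {measure set T -> \bar R}) (f g : T -> \bar R) :
  (forall x, 0 <= f x)%E -> (forall x, f x <= g x)%E ->
  (\int[mu]_x f x <= \int[mu]_x g x)%E.
Proof.
move=> f0 fg; have g0 x : (0 <= g x)%E by exact: le_trans (fg x).
rewrite !ge0_integralTE//; apply: le_ereal_sup => /= _ [h hf <-].
by exists h => // x; exact: le_trans (fg x).
Qed.

Lemma integral_rV_ge0 m (f : 'rV[R]_m -> \bar R) :
  (forall v, 0 <= f v)%E -> (0 <= integral_rV f)%E.
Proof.
elim: m f => [|m IH] f f0 /=; first exact: f0.
by apply: integral_ge0 => t _; apply: IH => v; exact: f0.
Qed.

Lemma le_integral_rV m (f g : 'rV[R]_m -> \bar R) :
  (forall v, 0 <= f v)%E -> (forall v, f v <= g v)%E ->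
  (integral_rV f <= integral_rV g)%E.
Proof.
elim: m f g => [|m IH] f g f0 fg /=; first exact: fg.
apply: nneg_le_integral => t.
  by apply: integral_rV_ge0 => v; exact: f0.
by apply: IH => v; [exact: f0|exact: fg].
Qed.

(** The half-width 2 is any number larger than 1: radial projections of these
    open cubes placed at y_i = 1 and y_i = -1 must cover all directions. *)
Definition cube m : set 'rV[R]_m := [set v | forall i, `|v 0 i| < 2].

Lemma cube_row_mx m (t : R) (v : 'rV[R]_m) :
  \1_(@cube (1 + m)) (row_mx (t%:M : 'M[R]_1) v) =
  \1_`]-2, 2[%classic t * \1_(@cube m) v :> R.
Proof.
have E : cube (row_mx (t%:M : 'M[R]_1) v) <-> (`]-2, 2[%classic t /\ cube v).
  split=> [H|[tI vC] i].
    split=> [|j]; last by have := H (rshift 1 j); rewrite row_mxEr.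
    by have := H (lshift m 0); rewrite row_mxEl mxE eqxx mulr1n /= in_itv/= ltr_norml.
  rewrite mxE; case: splitP => j _; last exact: vC.
  by move: tI; rewrite !ord1 mxE eqxx mulr1n /= in_itv/= ltr_norml.
rewrite !indicE -natrM mulnb; congr (nat_of_bool _)%:R.
by apply/idP/andP; rewrite !inE => H; apply/E.
Qed.

Lemma integral_rV_cube m (b : R) : 0 <= b ->
  integral_rV (fun v : 'rV[R]_m => (b * \1_(@cube m) v)%:E) = (b * 4 ^+ m)%:E.
Proof.
elim: m b => [|m IH] b b0 /=.
  by rewrite expr0 mulr1 indicE mem_set ?mulr1// => -[].
have step t : integral_rV (fun v : 'rV[R]_m =>
    (b * \1_(@cube (1 + m)) (row_mx (t%:M : 'M[R]_1) v))%:E) =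
    ((b * 4 ^+ m)%:E * (\1_`]-2, 2[%classic t)%:E)%E.
  rewrite (_ : (fun v => _) = fun v : 'rV[R]_m =>
     ((b * \1_`]-2, 2[%classic t) * \1_(@cube m) v)%:E); last first.
    by apply/funext => v; rewrite cube_row_mx mulrA.
  by rewrite IH ?mulr_ge0// mulrAC EFinM.
under eq_integral => t _ do rewrite step.
rewrite ge0_integralZl//=; last 2 first.
  by apply/measurable_EFinP; exact: measurable_indic.
  by rewrite lee_fin mulr_ge0// exprn_ge0.
rewrite integral_indic// setIT.
have := lebesgue_measure_itv (`]-2, 2[%R : interval R).
rewrite /= lte_fin ifT => [->|]; last lra.
rewrite -EFinB -EFinM; congr (_%:E); rewrite exprS; lra.
Qed.

End IteratedIntegral.

(** * Determinants and derivatives in coordinates *)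

(** Induction on the size through the Schur complement S of the upper left
    entry: the form of S at v is the form of A at (s, v), where s cancels the
    first coordinate of (s, v) A. *)
Lemma det_posform_gt0 (R : realFieldType) n (A : 'M[R]_n) :
  (forall v : 'rV[R]_n, v != 0 -> 0 < (v *m A *m v^T) 0 0) -> 0 < \det A.
Proof.
elim: n A => [|n IH] A; first by rewrite det_mx00.
move: A; rewrite -[n.+1]/(1 + n)%N => A posA.
set a := A 0 0; set b := ursubmx A; set c := dlsubmx A; set D := drsubmx A.
have ulA : ulsubmx A = a%:M.
  by apply/matrixP => i j; rewrite !ord1 !mxE eqxx mulr1n; congr (A _ _); apply/val_inj.
have a0 : 0 < a.
  have := posA (row_mx 1 0); rewrite -[A]submxK ulA mul_row_block tr_row_mx.
  rewrite !mul0mx !addr0 mul_row_col trmx1 trmx0 mulmx0 addr0 mulmx1 mul1mx.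
  rewrite mxE eqxx mulr1n; apply; apply/eqP => /rowP/(_ (lshift n 0)).
  by rewrite row_mxEl !mxE eqxx; apply/eqP; rewrite oner_eq0.
set S := D - a^-1 *: (c *m b).
have -> : A = block_mx 1 0 (a^-1 *: c) 1 *m block_mx a%:M b 0 S.
  rewrite mulmx_block !mul1mx !mul0mx !addr0 -[LHS]submxK ulA; congr block_mx.
    rewrite -scalemxAl mul_mx_scalar scalerA mulVf ?scale1r ?addr0// ?gt_eqF//.
  by rewrite -scalemxAl subrKC.
rewrite det_mulmx det_lblock det_ublock !det1 !mul1r det_scalar1.
rewrite mulr_gt0//; apply: IH => v v0.
set s := - a^-1 *: (v *m c).
have := posA (row_mx s v); rewrite -[A]submxK ulA mul_row_block tr_row_mx.
rewrite -/b -/c -/D mul_mx_scalar scalerA mulrN mulfV ?gt_eqF// scaleN1r addNr.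
rewrite mul_row_col mul0mx add0r (_ : s *m b + v *m D = v *m S).
  apply; apply: contra v0 => /eqP E; apply/eqP/rowP => j.
  by move/rowP: E => /(_ (rshift 1 j)); rewrite row_mxEr !mxE.
by rewrite /S /s scaleNr mulNmx -scalemxAl mulmxBr -scalemxAr mulmxA addrC.
Qed.

Lemma derive_sum_coord (R : realType) n (W : normedModType R)
    (f : 'rV[R]_n -> W) x v : differentiable f x ->
  'D_v f x = \sum_j v 0 j *: 'D_(delta_mx 0 j) f x.
Proof.
move=> df; rewrite deriveE// {1}(row_sum_delta v) linear_sum/=.
by apply: eq_bigr => j _; rewrite linearZ/= deriveE.
Qed.

Lemma derive_eq0_along (R : realType) (V W : normedModType R) (f : V -> W) x v :
  (\forall h \near (0 : R), f (h *: v + x) = 0) -> 'D_v f x = 0.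
Proof.
move=> f0; apply: cvg_lim => //; apply: cvg_near_cst.
have fx : f x = 0 by have := nbhs_singleton f0; rewrite scale0r add0r.
apply: cvg_within; apply: filterS f0 => h /= ->.
by rewrite fx subrr scaler0.
Qed.

Lemma linear_rV_continuous (R : realType) n (W : normedModType R)
  (f : {linear 'rV[R]_n -> W}) : continuous f.
Proof.
move=> x; apply: differentiable_continuous.
have -> : (f : _ -> _) = \sum_j (fun v : 'rV[R]_n => v 0 j *: f (delta_mx 0 j)).
  apply/funext => v; rewrite fct_sumE {1}(row_sum_delta v) linear_sum.
  by apply: eq_bigr => j _; rewrite linearZ.
apply: differentiable_sum => j.
by apply: differentiableZl; exact: differentiable_coord.
Qed.

Lemma ltr_norm_rV (R : realType) n (v : 'rV[R]_n) (c : R) : 0 < c ->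
  `|v| < c <-> forall i, `|v 0 i| < c.
Proof.
move=> c0; rewrite /Num.norm/= mx_normrE.
split=> [/bigmax_ltP[_ H] i|H]; first exact: (H (0, i)).
by apply/bigmax_ltP; split=> // -[i j] _; rewrite ord1; exact: H.
Qed.

Lemma cubeE (R : realType) n : @cube R n = [set v | `|v| < 2].
Proof. by apply/seteqP; split=> v /ltr_norm_rV; apply. Qed.

Lemma open_cube (R : realType) n : open (@cube R n).
Proof.
rewrite cubeE; apply: (@open_comp _ _ (fun v : 'rV[R]_n => `|v|) [set x | x < 2]).
  by move=> v _; exact: norm_continuous.
exact: open_lt.
Qed.

Lemma continuous_det (R : realType) (T : topologicalType) n
    (A : T -> 'M[R]_n) :
  (forall i j, continuous (fun t => A t i j)) -> continuous (fun t => \det (A t)).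
Proof.
move=> cA; rewrite /determinant.
apply: continuous_big => [|s _]; first exact: add_continuous.
move=> t; apply: cvgM; first exact: cvg_cst.
move: t; apply: continuous_big => [|i _]; first exact: mul_continuous.
exact: cA.
Qed.

Lemma open_neq0 (R : realType) n : open [set y : 'rV[R]_n | y != 0].
Proof.
rewrite (_ : mkset _ = (fun v : 'rV[R]_n => `|v|) @^-1` [set x | x != 0]).
  apply: open_comp; last exact: open_neq.
  by move=> v _; exact: norm_continuous.
by apply/seteqP; split=> v /=; rewrite normr_eq0.
Qed.

(** * The volume of the indicatrix of a Minkowski norm *)

Section MinkowskiNorm.
Context {R : realType} {m : nat} (l : 'rV[R]_m.+1 -> R).
Let E := 'rV[R]_m.+1.
Let E' := 'rV[R]_m.
Let q (y : E) : R := l y ^+ 2.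
(** The fundamental tensor of l; it is the tensor fund of the Finsler function
    restricted to one fibre (see fibre_metricE). *)
Definition hess (y : E) : 'M[R]_m.+1 :=
  \matrix_(i, j) (2^-1 * 'D_(delta_mx 0 i) ('D_(delta_mx 0 j) q) y).

Context (l_ge0 : forall y, 0 <= l y)
  (l_smooth : smooth_on [set y : E | y != 0] l)
  (l_homo : forall (y : E) c, 0 < c -> l (c *: y) = c * l y)
  (hess_pos : forall y : E, y != 0 -> forall v : E, v != 0 ->
     0 < (v *m hess y *m v^T) 0 0).

Let q_smooth : smooth_on [set y : E | y != 0] q.
Proof.
move=> k; apply: (Ck_on_eq (f := fun y => l y * l y)) => //.
- exact: open_neq0.
- by apply: Ck_onM => //; exact: open_neq0.
Qed.

Lemma minkowski_norm0 : l 0 = 0.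
Proof.
have : l (2 *: 0) = 2 * l 0 by exact: l_homo.
rewrite scaler0; lra.
Qed.

(** The form only involves the second derivative of l^2 along one direction,
    which is how homogeneity can be applied to it. *)
Lemma hess_quadratic (y v : E) : y != 0 ->
  (v *m hess y *m v^T) 0 0 = 2^-1 * 'D_v ('D_v q) y.
Proof.
move=> y0.
have -> : 'D_v ('D_v q) y = 'D_v (\sum_j v 0 j \*: 'D_(delta_mx 0 j) q) y.
  apply: near_eq_derive.
  have : nbhs y [set y : E | y != 0] by apply: open_nbhs_nbhs; split => //; exact: open_neq0.
  apply: filterS => z z0; rewrite fct_sumE derive_sum_coord//.
  by case: (q_smooth 1) => + _; apply.
have dD j : differentiable ('D_(delta_mx 0 j) q) y.
  by case: (q_smooth 2) => _ /(_ (delta_mx 0 j))[+ _]; apply.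
rewrite derive_sum => [|j]; last first.
  by apply: derivableZ; exact: diff_derivable.
rewrite mxE mulr_sumr; apply: eq_bigr => j _.
rewrite deriveZ; last exact: diff_derivable.
rewrite derive_sum_coord// !mxE mulr_suml scaler_sumr mulr_sumr.
apply: eq_bigr => i _; rewrite !mxE /GRing.scale/=; ring.
Qed.

(** If l vanished at y, then by homogeneity l^2 would vanish on the whole ray
    through y, and so would its second derivative along y; but that derivative
    is twice the fundamental tensor evaluated on y. *)
Lemma minkowski_norm_gt0 y : y != 0 -> 0 < l y.
Proof.
move=> y0; rewrite lt_neqAle l_ge0 andbT; apply/negP => /eqP ly0.
have := hess_pos y0 y0; rewrite hess_quadratic// (_ : 'D_y _ y = 0) ?mulr0 ?ltxx//.
have qz c : 0 < c -> q (c *: y) = 0.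
  by move=> c0; rewrite /q l_homo// -ly0 mulr0 expr0n.
have near_pos (c : R) : 0 < c -> \forall h \near (0 : R), 0 < h + c.
  move=> c0; near=> h; rewrite -ltrBlDr sub0r; near: h.
  by apply: open_nbhs_nbhs; split; [exact: open_gt|rewrite /= oppr_lt0].
(* first derivative along the ray, at each of its points *)
have Dz c : 0 < c -> 'D_y q (c *: y) = 0.
  move=> c0; apply: derive_eq0_along.
  by apply: filterS (near_pos _ c0) => h hc; rewrite -scalerDl qz.
apply: derive_eq0_along; apply: filterS (near_pos 1 ltr01) => h hc.
by rewrite -{2}(scale1r y) -scalerDl Dz.
Unshelve. all: by end_near. Qed.

(** Linear part of the parametrization of the hyperplane y_i = e by its
    remaining coordinates. *)
Definition slice_dir (i : 'I_m.+1) : 'M[R]_(m, m.+1) :=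
  \matrix_(j, k) (k == lift i j)%:R.

Definition slice (i : 'I_m.+1) (e : R) (t : E') : E :=
  t *m slice_dir i + e *: delta_mx 0 i.

Lemma slice_dir_axis i (t : E') : (t *m slice_dir i) 0 i = 0.
Proof.
rewrite mxE big1// => j _; rewrite mxE (negbTE (neq_lift i j)) mulr0//.
Qed.

Lemma slice_dir_lift i (t : E') j : (t *m slice_dir i) 0 (lift i j) = t 0 j.
Proof.
rewrite mxE (bigD1 j)//= mxE eqxx mulr1 big1 ?addr0// => k kj.
by rewrite mxE (inj_eq lift_inj) eq_sym (negbTE kj) mulr0.
Qed.

Lemma slice_axis i e t : slice i e t 0 i = e.
Proof. by rewrite mxE slice_dir_axis add0r !mxE !eqxx mulr1. Qed.

Lemma slice_lift i e t j : slice i e t 0 (lift i j) = t 0 j.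
Proof.
by rewrite mxE slice_dir_lift !mxE eqxx/= eq_sym (negbTE (neq_lift i j)) mulr0 addr0.
Qed.

Lemma rowP_lift (i : 'I_m.+1) (y z : E) :
  y 0 i = z 0 i -> (forall j, y 0 (lift i j) = z 0 (lift i j)) -> y = z.
Proof.
by move=> H H'; apply/rowP => k; case: (unliftP i k) => [j|] ->.
Qed.

Lemma slice_neq0 i e t : e != 0 -> slice i e t != 0.
Proof.
apply: contra_neq => H; by rewrite -(slice_axis i e t) H mxE.
Qed.

(** Radial projection of the hyperplane y_i = e onto the indicatrix. *)
Definition radial (i : 'I_m.+1) (e : R) (t : E') : E :=
  (l (slice i e t))^-1 *: slice i e t.

Lemma radial_coord i e t k :
  radial i e t 0 k = (l (slice i e t))^-1 * slice i e t 0 k.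
Proof. by rewrite mxE. Qed.

Lemma slice_Ck k A i e : Ck_on k A (slice i e).
Proof.
apply: (@Ck_on_affine _ _ _ _ _ (mulmxr (slice_dir i))).
exact: linear_rV_continuous.
Qed.

Lemma radius_Ck k i e : e != 0 ->
  Ck_on k setT (fun t => (l (slice i e t))^-1).
Proof.
move=> e0; apply: Ck_onV => [|t _|]; first exact: openT.
  by rewrite gt_eqF// minkowski_norm_gt0// slice_neq0.
have H := @Ck_on_comp_affine _ k _ _ _ _ l (mulmxr (slice_dir i))
  (e *: delta_mx 0 i) (@linear_rV_continuous _ _ _ _) (l_smooth k).
by apply: Ck_on_sub H => t _ /=; exact: slice_neq0.
Qed.

Lemma radial_smooth i e : e != 0 -> smooth_on setT (radial i e).
Proof.
move=> e0 k; apply: Ck_on_rV => [|j]; first exact: openT.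
apply: (Ck_on_eq (f := fun t => (l (slice i e t))^-1 * slice i e t 0 j)) => //.
- exact: openT.
- by move=> t _; rewrite radial_coord.
apply: Ck_onM; [exact: openT|exact: radius_Ck|].
by apply: Ck_on_coord; [exact: openT|exact: slice_Ck].
Qed.

Lemma radial_differentiable i e t : e != 0 -> differentiable (radial i e) t.
Proof. by move=> e0; case: (radial_smooth i e0 1) => + _; apply. Qed.

Lemma radial_neq0 i e t : e != 0 -> radial i e t != 0.
Proof.
move=> e0; rewrite scaler_eq0 negb_or slice_neq0// andbT invr_eq0.
by rewrite gt_eqF// minkowski_norm_gt0// slice_neq0.
Qed.

Lemma radial_norm i e t : e != 0 -> l (radial i e t) = 1.
Proof.
move=> e0; have lp : 0 < l (slice i e t) by rewrite minkowski_norm_gt0// slice_neq0.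
by rewrite l_homo ?invr_gt0// mulVf// gt_eqF.
Qed.

Lemma radial_inj i e : e != 0 -> injective (radial i e).
Proof.
move=> e0 s t st.
have H k : (l (slice i e s))^-1 * slice i e s 0 k =
           (l (slice i e t))^-1 * slice i e t 0 k by rewrite -!radial_coord st.
have r_eq : (l (slice i e s))^-1 = (l (slice i e t))^-1.
  by apply: (mulIf e0); have := H i; rewrite !slice_axis.
apply/rowP => j; have := H (lift i j); rewrite !slice_lift r_eq.
by apply: mulfI; rewrite invr_eq0 gt_eqF// minkowski_norm_gt0// slice_neq0.
Qed.

(** The i-th coordinate of the hyperplane is the constant e, so the i-th
    coordinate of a vanishing derivative says that 1 / l has derivative 0; the
    other coordinates then say that w vanishes. *)
Lemma radial_immersion i e t w : e != 0 -> 'd (radial i e) t w = 0 -> w = 0.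
Proof.
move=> e0; have dr := radial_differentiable i t e0.
rewrite -deriveE// => Dw.
set r := fun t => (l (slice i e t))^-1.
have dr1 : differentiable r t by case: (radius_Ck 1 i e0) => + _; apply.
have ds : differentiable (slice i e) t by case: (@slice_Ck 1 setT i e) => + _; apply.
have Ds k : 'D_w (fun t => slice i e t 0 k) t = (w *m slice_dir i) 0 k.
  have -> : 'D_w (fun t => slice i e t 0 k) t = ('D_w (slice i e) t) 0 k.
    by rewrite derive_mx ?mxE//; exact: diff_derivable.
  congr (_ _ _ _); apply: cvg_lim => //; apply: cvg_near_cst.
  apply: filterS (@nbhs_dnbhs_neq _ _) => h h0.
  (* the difference quotient of an affine map is constant *)
  rewrite /= /slice mulmxDl -scalemxAl -[X in X - _]addrA addrK.
  by rewrite scalerA mulVf ?scale1r.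
have dsk k : differentiable (fun t => slice i e t 0 k) t.
  apply: (@differentiable_comp _ _ _ _ (slice i e) (fun M : E => M 0 k : R)) => //.
  exact: differentiable_coord.
have coord k : r t * (w *m slice_dir i) 0 k + slice i e t 0 k * 'D_w r t = 0.
  have := Dw; rewrite derive_mx; last exact: diff_derivable.
  move=> /rowP/(_ k); rewrite mxE [RHS]mxE.
  rewrite (_ : (fun t => radial i e t 0 k) = r * (fun t => slice i e t 0 k)); last first.
    by apply/funext => u; rewrite radial_coord.
  by rewrite deriveM ?Ds//; exact: diff_derivable.
have Dr : 'D_w r t = 0.
  have := coord i; rewrite slice_dir_axis mulr0 add0r slice_axis => /eqP.
  by rewrite mulf_eq0 (negbTE e0) => /eqP.
apply/rowP => j; have := coord (lift i j).
rewrite Dr mulr0 addr0 slice_dir_lift => /eqP; rewrite mulf_eq0 invr_eq0.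
by rewrite gt_eqF ?minkowski_norm_gt0 ?slice_neq0//= mxE => /eqP.
Qed.

Definition gram_radial i e (t : E') : 'M[R]_m :=
  \matrix_(a, b) ('D_(delta_mx 0 a) (radial i e) t *m hess (radial i e t)
                  *m ('D_(delta_mx 0 b) (radial i e) t)^T) 0 0.

Lemma gram_radial_continuous i e a b : e != 0 ->
  continuous (fun t => gram_radial i e t a b).
Proof.
move=> e0.
have cD c k : continuous (fun t => ('D_(delta_mx 0 c) (radial i e) t) 0 k).
  move=> t; apply: (@Ck_on_continuous _ 0 _ _ setT) => //.
  apply: Ck_on_coord; first exact: openT.
  by case: (radial_smooth i e0 1) => _; apply.
have ch k k' : continuous (fun t => hess (radial i e t) k k').
  move=> t; apply: (@continuous_comp _ _ _ (radial i e) (fun y => hess y k k')).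
    exact: differentiable_continuous (radial_differentiable _ _ e0).
  have -> : (fun y => hess y k k') =
      (fun y => 2^-1 * 'D_(delta_mx 0 k) ('D_(delta_mx 0 k') q) y).
    by apply/funext => y; rewrite mxE.
  apply: (@continuousM _ _ (fun=> 2^-1) ('D_(delta_mx 0 k) ('D_(delta_mx 0 k') q))).
    exact: cst_continuous.
  have [_ /(_ (delta_mx 0 k'))[_ /(_ (delta_mx 0 k))]] := q_smooth 2.
  by apply; exact: radial_neq0.
have -> : (fun t => gram_radial i e t a b) =
    (fun t => \sum_k (\sum_k' ('D_(delta_mx 0 a) (radial i e) t) 0 k' *
       hess (radial i e t) k' k) * ('D_(delta_mx 0 b) (radial i e) t) 0 k).
  apply/funext => t; rewrite mxE mxE; apply: eq_bigr => k _.
  by rewrite mxE [X in _ * X]mxE.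
apply: continuous_big => [|k _]; first exact: add_continuous.
have cS : continuous (fun t => \sum_k' ('D_(delta_mx 0 a) (radial i e) t) 0 k' *
    hess (radial i e t) k' k).
  apply: continuous_big => [|k' _]; first exact: add_continuous.
  by move=> t; exact: continuousM (cD a k' t) (ch k' k t).
by move=> t; exact: continuousM (cS t) (cD b k t).
Qed.

(** The Gram matrix is J g J^T with J the Jacobian matrix, whose rows are
    independent because the projection is an immersion. *)
Lemma gram_radial_det_gt0 i e t : e != 0 -> 0 < \det (gram_radial i e t).
Proof.
move=> e0; have dr := radial_differentiable i t e0.
set J : 'M[R]_(m, m.+1) := \matrix_a 'D_(delta_mx 0 a) (radial i e) t.
have gramE : gram_radial i e t = J *m hess (radial i e t) *m J^T.
  apply/matrixP => a b; rewrite !mxE; apply: eq_bigr => k _.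
  rewrite !mxE; congr (_ * _); apply: eq_bigr => k' _.
  by rewrite !mxE.
apply: det_posform_gt0 => v v0.
have vJ : 'd (radial i e) t v = v *m J.
  rewrite -deriveE// derive_sum_coord//; apply/rowP => k; rewrite !mxE summxE.
  by apply: eq_bigr => j _; rewrite !mxE.
rewrite gramE 2!mulmxA -(mulmxA _ _ v^T) -trmx_mul; apply: hess_pos.
  exact: radial_neq0.
rewrite -vJ; apply: contra_neq v0; exact: radial_immersion.
Qed.

(** The open cone over the cube in the hyperplane y_i = e, for e = 1 or -1; the
    maximum norm makes one inequality express all bounds and the sign of y_i. *)
Definition wedge i e : set E := [set y : E | `|y| < 2 * (e * y 0 i)].

Lemma open_wedge i e : open (wedge i e).
Proof.
rewrite (_ : wedge i e =
  (fun y : E => `|y| - 2 * (e * y 0 i)) @^-1` [set x | x < 0]); last first.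
  by apply/seteqP; split=> y; rewrite /wedge/= subr_lt0.
apply: open_comp; last exact: open_lt.
move=> y _.
apply: (@continuousB _ _ _ (fun y : E => `|y|) (fun y : E => 2 * (e * y 0 i))).
  exact: norm_continuous.
apply: (@continuousM _ _ (fun=> 2) (fun y : E => e * y 0 i)).
  exact: cst_continuous.
apply: (@continuousM _ _ (fun=> e) (fun y : E => y 0 i)).
  exact: cst_continuous.
exact: coord_continuous.
Qed.

Lemma radial_image i e : e = 1 \/ e = -1 ->
  radial i e @` @cube R m = [set y | l y = 1] `&` wedge i e.
Proof.
move=> e1; have ee : e * e = 1 by case: e1 => ->; rewrite ?mulr1// mulrNN mulr1.
have e0 : e != 0 by apply: contra_eq_neq ee => ->; rewrite mulr0 eq_sym oner_eq0.
have ne : `|e| = 1 by case: e1 => ->; rewrite ?normrN normr1.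
apply/seteqP; split=> [_ [t tc <-]|y [/= ly yw]].
  split; first exact: radial_norm.
  have rp : 0 < (l (slice i e t))^-1 by rewrite invr_gt0 minkowski_norm_gt0// slice_neq0.
  have two : 2 * (e * radial i e t 0 i) = 2 * (l (slice i e t))^-1.
    by rewrite radial_coord slice_axis [e * _]mulrCA ee mulr1.
  rewrite /wedge/= two; apply/ltr_norm_rV => [|k]; first by rewrite mulr_gt0.
  rewrite radial_coord normrM (gtr0_norm rp) mulrC ltr_pM2r//.
  case: (unliftP i k) => [j|] ->; last by rewrite slice_axis ne ltr1n.
  by rewrite slice_lift; exact: tc.
have cp : 0 < e * y 0 i.
  by rewrite -(pmulr_rgt0 _ (ltr0n _ 2)) (le_lt_trans _ yw).
set c := e * y 0 i in yw cp.
have yi : y 0 i = e * c by rewrite /c mulrA ee mul1r.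
exists (\row_j (c^-1 * y 0 (lift i j))).
  move=> j; rewrite mxE normrM normfV (gtr0_norm cp) mulrC ltr_pdivrMr//.
  by move: yw => /ltr_norm_rV; apply; rewrite mulr_gt0.
set t := \row_j _.
have sE : slice i e t = c^-1 *: y.
  apply: (@rowP_lift i) => [|j].
    by rewrite slice_axis mxE yi mulrCA mulVf ?mulr1// gt_eqF.
  by rewrite slice_lift !mxE.
rewrite /radial sE l_homo ?invr_gt0// ly mulr1 invrK scalerA mulfV ?scale1r//.
by rewrite gt_eqF.
Qed.

(** Take for i a coordinate of largest absolute value. *)
Lemma wedge_cover y : y != 0 -> exists i, wedge i 1 y \/ wedge i (-1) y.
Proof.
move=> y0; pose i := [arg max_(k > ord0) `|y 0 k|]%O.
have imax k : `|y 0 k| <= `|y 0 i| by rewrite /i; case: arg_maxP => // j _; apply.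
have yi0 : 0 < `|y 0 i|.
  rewrite lt_neqAle normr_ge0 andbT eq_sym; apply: contra_neq y0 => yi0.
  by apply/rowP => k; rewrite mxE; apply/eqP; rewrite -normr_le0 -yi0.
have yw : `|y| < 2 * `|y 0 i|.
  apply/ltr_norm_rV => [|k]; first by rewrite mulr_gt0.
  by apply: le_lt_trans (imax k) _; lra.
exists i; rewrite /wedge/= mul1r mulN1r.
by case: (ger0P (y 0 i)) yw => _; [left|right].
Qed.

Lemma indicatrix_open_complement :
  open [set y : E | y != 0 /\ l y != 1].
Proof.
rewrite openE => y [/= y0 ly]; rewrite /interior.
apply: filterI; first by apply: open_nbhs_nbhs; split=> //; exact: open_neq0.
have n1 : nbhs (l y) [set x : R | x != 1].
  by apply: open_nbhs_nbhs; split=> //; exact: open_neq.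
exact: (Ck_on_continuous (l_smooth 0) y0 n1).
Qed.

(** Borel sets come from open sets, and l is only known to be continuous off
    the origin; this writes the indicatrix as a difference of open sets. *)
Lemma indicatrixE : [set y | l y = 1] =
  [set y : E | y != 0] `\` [set y : E | y != 0 /\ l y != 1].
Proof.
apply/seteqP; split=> y /=.
  move=> ly; split; last by rewrite ly eqxx => -[].
  by apply: contra_eq_neq ly => ->; rewrite minkowski_norm0 eq_sym oner_eq0.
move=> [y0 H]; apply/eqP; apply: contrapT => /negP ly; exact: H.
Qed.

Lemma indicatrix_borel :
  measurable ([set y | l y = 1] : set (@borel_rV R m.+1)).
Proof.
by rewrite indicatrixE; apply: measurableD; apply: sub_sigma_algebra;
  [exact: open_neq0|exact: indicatrix_open_complement].
Qed.

Lemma radial_image_borel i e : e = 1 \/ e = -1 ->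
  measurable (radial i e @` @cube R m : set (@borel_rV R m.+1)).
Proof.
move=> e1; rewrite radial_image//; apply: measurableI; first exact: indicatrix_borel.
by apply: sub_sigma_algebra; exact: open_wedge.
Qed.

(** The Gram determinant is continuous and positive, so it is bounded above and
    away from 0 on the closed cube; the integral is squeezed between the
    integrals of two constants over the open cube. *)
Lemma radial_volume_bounds i e : e != 0 ->
  (0 < integral_rV (fun t => (\1_(@cube R m) t *
     Num.sqrt (\det (gram_radial i e t)))%:E) < +oo)%E.
Proof.
move=> e0; pose D t := \det (gram_radial i e t).
pose K := [set v : 'rV[R]_m | forall i, `[-2, 2]%classic (v ord0 i)].
have K0 : K !=set0.
  by exists 0 => j; rewrite mxE/= in_itv/=; apply/andP; split; lra.
have cK : compact K.
  apply: (@rV_compact _ _ (fun=> `[-2 : R, 2]%classic)) => _.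
  exact: segment_compact.
have cD : {within K, continuous D}.
  apply: continuous_subspaceT; apply: continuous_det => a b.
  exact: gram_radial_continuous.
have sub t : cube t -> t \in K.
  move=> tc; rewrite inE => j; have := tc j; rewrite ltr_norml /= in_itv/=.
  by case/andP => h1 h2; rewrite !ltW.
have [tmax _ Hmax] := EVT_max_rV K0 cK cD.
have [tmin _ Hmin] := EVT_min_rV K0 cK cD.
have Dmin : 0 < D tmin by exact: gram_radial_det_gt0.
have ge0 (a : R) v : 0 <= a -> (0 <= (a * \1_(@cube R m) v)%:E)%E.
  by move=> a0; rewrite lee_fin mulr_ge0// indicE.
have mono (a b : R) v : (cube v -> a <= b) ->
    ((a * \1_(@cube R m) v)%:E <= (b * \1_(@cube R m) v)%:E)%E.
  move=> ab; rewrite lee_fin indicE.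
  have [vc|_] := boolP (v \in @cube R m); last by rewrite !mulr0.
  by rewrite !mulr1; apply: ab; rewrite inE in vc.
have -> : (fun t => (\1_(@cube R m) t * Num.sqrt (\det (gram_radial i e t)))%:E) =
    (fun t => (Num.sqrt (D t) * \1_(@cube R m) t)%:E).
  by apply/funext => t; rewrite mulrC.
apply/andP; split.
  apply: (@lt_le_trans _ _ (Num.sqrt (D tmin) * 4 ^+ m)%:E).
    by rewrite lte_fin mulr_gt0 ?sqrtr_gt0// exprn_gt0.
  rewrite -integral_rV_cube; last exact: sqrtr_ge0.
  apply: le_integral_rV => v.
    by apply: ge0; exact: sqrtr_ge0.
  by apply: mono => /sub vK; apply: ler_wsqrtr; exact: Hmin.
apply: (@le_lt_trans _ _ (Num.sqrt (D tmax) * 4 ^+ m)%:E); last exact: ltry.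
rewrite -integral_rV_cube; last exact: sqrtr_ge0.
apply: le_integral_rV => v.
  by apply: ge0; exact: sqrtr_ge0.
by apply: mono => /sub vK; apply: ler_wsqrtr; exact: Hmax.
Qed.

Lemma indicatrix_volume_bounds (mu : {measure set (@borel_rV R m.+1) -> \bar R}) :
  (forall i e, e = 1 \/ e = -1 -> mu (radial i e @` @cube R m) =
     integral_rV (fun t => (\1_(@cube R m) t *
       Num.sqrt (\det (gram_radial i e t)))%:E)) ->
  (0 < mu [set y : E | l y = 1%R] < +oo)%E.
Proof.
move=> muE; have patch i e : e = 1 \/ e = -1 ->
    (0 < mu (radial i e @` @cube R m) < +oo)%E.
  move=> e1; rewrite muE//; apply: radial_volume_bounds.
  by case: e1 => ->; rewrite ?oppr_eq0 oner_eq0.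
apply/andP; split.
  have /andP[p0 _] := patch ord0 1 (or_introl erefl).
  apply: lt_le_trans p0 _; apply: le_measure; rewrite ?inE.
  - by apply: radial_image_borel; left.
  - exact: indicatrix_borel.
  - by rewrite radial_image; [exact: subIsetl|left].
pose B i := radial i 1 @` @cube R m `|` radial i (-1) @` @cube R m.
have mB i : measurable (B i : set (@borel_rV R m.+1)).
  by apply: measurableU; apply: radial_image_borel; [left|right].
have fB i : (mu (B i) < +oo)%E.
  apply: le_lt_trans (measureU2 _ _ _) _.
  - by apply: radial_image_borel; left.
  - by apply: radial_image_borel; right.
  have /andP[_ p1] := patch i 1 (or_introl erefl).
  have /andP[_ p2] := patch i (-1) (or_intror erefl).
  by rewrite lte_add_pinfty.
have [mU fU] : measurable (\big[setU/set0]_i B i : set (@borel_rV R m.+1)) /\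
    (mu (\big[setU/set0]_i B i) < +oo)%E.
  elim/big_rec : _ => [|i A _ [mA fA]]; first by rewrite measure0.
  split; first exact: measurableU.
  apply: le_lt_trans (measureU2 _ _ _) _ => //.
  exact: lte_add_pinfty (fB i) fA.
apply: le_lt_trans fU; apply: le_measure; rewrite ?inE//.
  exact: indicatrix_borel.
move=> y /= ly; have y0 : y != 0.
  by apply: contra_eq_neq ly => ->; rewrite minkowski_norm0 eq_sym oner_eq0.
have [i wi] := wedge_cover y0.
rewrite -bigcup_seq; exists i; first by rewrite /= mem_index_enum.
by case: wi => wi; [left|right]; rewrite radial_image; [split|left|split|right].
Qed.

End MinkowskiNorm.

(** * Changes of chart on the manifold and on its tangent bundle *)

Section ChangeOfChart.
Context {R : realType} {n : nat} {M : manifold R n}.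
Local Notation E := 'rV[R]_n.
Implicit Types (c : chart R n M) (p : M).

Lemma open_overlap c c' : open (cmap c @` (cdom c `&` cdom c')).
Proof.
rewrite openE => x [p [cp c'p] <-]; rewrite /interior.
have cx : (cmap c @` cdom c) (cmap c p) by exists p.
have near1 : nbhs (cmap c p) (cmap c @` cdom c).
  by apply: open_nbhs_nbhs; split=> //; exact: cimage_open.
have near2 : nbhs (cmap c p) (cinv c @^-1` cdom c').
  apply: (cinv_continuous cx); rewrite cmapK//.
  by apply: open_nbhs_nbhs; split=> //; exact: cdom_open.
apply: filterS2 near1 near2 => _ [p' cp' <-] /=.
by rewrite cmapK// => c'p'; exists p'.
Qed.

Lemma nbhs_overlap c c' x : (cmap c @` (cdom c `&` cdom c')) x ->
  nbhs x (cmap c @` (cdom c `&` cdom c')).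
Proof. by move=> ox; apply: open_nbhs_nbhs; split=> //; exact: open_overlap. Qed.

Lemma nbhs_overlap2 c c' (z : E * E) : (cmap c @` (cdom c `&` cdom c')) z.1 ->
  nbhs z [set y | (cmap c @` (cdom c `&` cdom c')) y.1].
Proof. by move=> /nbhs_overlap oz; exact: (@cvg_fst _ _ _ _ _ _ oz). Qed.

Lemma transitionE c c' p : cdom c p -> transition c c' (cmap c p) = cmap c' p.
Proof. by move=> cp; rewrite /transition/= cmapK. Qed.

Lemma transitionK c c' x : (cmap c @` (cdom c `&` cdom c')) x ->
  transition c' c (transition c c' x) = x.
Proof. by move=> [p [cp c'p] <-]; rewrite !transitionE. Qed.

Lemma transition_smooth c c' : atlas c -> atlas c' ->
  smooth_on (cmap c @` (cdom c `&` cdom c')) (transition c c').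
Proof. by move=> ac ac'; case: (atlas_compatible ac ac'). Qed.

Lemma transition_differentiable c c' x : atlas c -> atlas c' ->
  (cmap c @` (cdom c `&` cdom c')) x -> differentiable (transition c c') x.
Proof. by move=> ac ac'; case: (transition_smooth ac ac' 1) => + _; apply. Qed.

Lemma diff_transitionK c c' p (v : E) : atlas c -> atlas c' ->
  cdom c p -> cdom c' p ->
  'd (transition c' c) (cmap c' p) ('d (transition c c') (cmap c p) v) = v.
Proof.
move=> ac ac' cp c'p.
have ox : (cmap c @` (cdom c `&` cdom c')) (cmap c p) by exists p.
have ox' : (cmap c' @` (cdom c' `&` cdom c)) (cmap c' p) by exists p.
rewrite -(transitionE c' cp).
have d1 := transition_differentiable ac ac' ox.
have d2 : differentiable (transition c' c) (transition c c' (cmap c p)).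
  by rewrite transitionE//; exact: transition_differentiable.
have K : 'd (transition c' c \o transition c c') (cmap c p) = idfun :> (E -> E).
  rewrite (@near_eq_diff _ _ _ _ idfun)//.
  - by rewrite diff_lin// => y; exact: cvg_id.
  - apply: filterS (nbhs_overlap ox) => y oy.
    by rewrite /= transitionK.
  - exact: differentiable_comp.
exact: (etrans (esym (congr1 (@^~ v) (diff_comp d1 d2))) (congr1 (@^~ v) K)).
Qed.

Lemma tan_vecK c p (a : E) : atlas c -> cdom c p ->
  tan_coord c (tan_vec c p a) = a.
Proof.
move=> ac cp; apply: diff_transitionK => //.
  exact: chart_at_atlas.
exact: chart_at_dom.
Qed.

Lemma tan_coordK c p (v : tangent p) : atlas c -> cdom c p ->
  tan_vec c p (tan_coord c v) = v.
Proof.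
move=> ac cp; apply: diff_transitionK => //.
  exact: chart_at_atlas.
exact: chart_at_dom.
Qed.

Lemma tan_coord_chart_at p (v : tangent p) : tan_coord (chart_at p) v = v.
Proof.
have cp := chart_at_dom p; rewrite /tan_coord.
have ox : (cmap (chart_at p) @` (cdom (chart_at p) `&` cdom (chart_at p)))
  (cmap (chart_at p) p) by exists p.
have -> : 'd (transition (chart_at p) (chart_at p)) (cmap (chart_at p) p) =
    idfun :> (E -> E) => //.
rewrite (@near_eq_diff _ _ _ _ idfun)//.
- by rewrite diff_lin// => y; exact: cvg_id.
- apply: filterS (nbhs_overlap ox) => y [q [qc _] <-].
  by rewrite transitionE.
- by apply: transition_differentiable => //; exact: chart_at_atlas.
Qed.

(** The fibre component 'd t x y is, near the point, the sum of the products
    y_i * 'D_i t x, each factor of which is differentiable. *)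
Lemma tangent_transition_diff c c' (z w : E * E) : atlas c -> atlas c' ->
  (cmap c @` (cdom c `&` cdom c')) z.1 ->
  differentiable (tangent_transition c c') z /\
  ('d (tangent_transition c c') z w).1 = 'd (transition c c') (z.1) (w.1).
Proof.
move=> ac ac' oz; set t := transition c c'.
have cfst : continuous (fst : E * E -> E) by move=> y; exact: cvg_fst.
have csnd : continuous (snd : E * E -> E) by move=> y; exact: cvg_snd.
have dfst : differentiable (fst : E * E -> E) z by exact: linear_differentiable.
have dsnd : differentiable (snd : E * E -> E) z by exact: linear_differentiable.
have dt : differentiable t z.1 by exact: transition_differentiable.
have d1 : differentiable (t \o fst) z by exact: differentiable_comp.
have d2 : differentiable (fun z : E * E => 'd t (z.1) (z.2)) z.
  pose g (z : E * E) : E := \sum_i z.2 0 i *: 'D_(delta_mx 0 i) t z.1.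
  apply: (@near_eq_differentiable _ _ _ g).
    apply: filterS (nbhs_overlap2 oz) => y oy.
    have dty : differentiable t y.1 by exact: transition_differentiable.
    by rewrite /g -deriveE// -derive_sum_coord.
  apply: differentiable_rV => k.
  have -> : (fun y => g y 0 k) = \sum_i ((fun y : E * E => y.2 0 i) *
      (fun y : E * E => ('D_(delta_mx 0 i) t y.1) 0 k)).
    by apply/funext => y; rewrite fct_sumE summxE; apply: eq_bigr => i _; rewrite mxE.
  apply: differentiable_sum => i; apply: differentiableM.
    apply: (@differentiable_comp _ _ _ _ (snd : E * E -> E) (fun M : E => M 0 i : R)) => //.
    exact: differentiable_coord.
  apply: (@differentiable_comp _ _ _ _ (fst : E * E -> E)
    (fun x => ('D_(delta_mx 0 i) t x) 0 k)) => //.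
  apply: (@differentiable_comp _ _ _ _ ('D_(delta_mx 0 i) t) (fun M : E => M 0 k : R)).
    by case: (transition_smooth ac ac' 2) => _ /(_ (delta_mx 0 i))[+ _]; apply.
  exact: differentiable_coord.
split; first exact: (differentiable_pair d1 d2).
rewrite (_ : tangent_transition c c' = fun z => ((t \o fst) z, 'd t (z.1) (z.2)))//.
rewrite diff_pair//= diff_comp//=.
by rewrite diff_lin.
Qed.

Lemma diff_tangent_transitionK c c' (z w : E * E) : atlas c -> atlas c' ->
  (cmap c @` (cdom c `&` cdom c')) z.1 ->
  'd (tangent_transition c' c) (tangent_transition c c' z)
    ('d (tangent_transition c c') z w) = w.
Proof.
move=> ac ac' oz.
have [d1 _] := tangent_transition_diff w ac ac' oz.
have oz' : (cmap c' @` (cdom c' `&` cdom c)) (tangent_transition c c' z).1.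
  by case: oz => p [cp c'p] e; rewrite /tangent_transition/= -e transitionE//; exists p.
have [d2 _] := tangent_transition_diff w ac' ac oz'.
have K : 'd (tangent_transition c' c \o tangent_transition c c') z = idfun
    :> (E * E -> E * E).
  rewrite (@near_eq_diff _ _ _ _ idfun)//.
  - by rewrite diff_lin// => y; exact: cvg_id.
  - apply: filterS (nbhs_overlap2 oz) => -[x y] /= [p [cp c'p] <-].
    rewrite /tangent_transition/= (transitionE c' cp) (transitionE c c'p).
    by rewrite diff_transitionK.
  - exact: differentiable_comp.
exact: (etrans (esym (congr1 (@^~ w) (diff_comp d1 d2))) (congr1 (@^~ w) K)).
Qed.

Lemma Tcoord_transition c (u : TM M) :
  tangent_transition (chart_at (base u)) c (Tcoord (chart_at (base u)) u)
  = Tcoord c u.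
Proof.
rewrite /tangent_transition /Tcoord/= tan_coord_chart_at transitionE//.
exact: chart_at_dom.
Qed.

Lemma overlap_chart_at c (u : TM M) : cdom c (base u) ->
  (cmap (chart_at (base u)) @` (cdom (chart_at (base u)) `&` cdom c))
    (Tcoord (chart_at (base u)) u).1.
Proof. by move=> cu; exists (base u) => //; split=> //; exact: chart_at_dom. Qed.

Lemma dtan_coordK c (u : TM M) (V : dtangent u) : atlas c -> cdom c (base u) ->
  dtan_vec c u (dtan_coord c V) = V.
Proof.
move=> ac cu; rewrite /dtan_vec /dtan_coord -Tcoord_transition.
apply: diff_tangent_transitionK => //; first exact: chart_at_atlas.
exact: overlap_chart_at.
Qed.

Lemma dtan_coord_fst c (u : TM M) (V : dtangent u) : atlas c -> cdom c (base u) ->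
  (dtan_coord c V).1 = @tan_coord _ _ M c (base u) V.1.
Proof.
move=> ac cu.
by have [_ ->] := tangent_transition_diff V (chart_at_atlas (base u)) ac
  (overlap_chart_at cu).
Qed.

(** The base component of a tangent vector of TM is insensitive to the fibre
    components; so dtan_vec maps d/dx^k to a vector over d/dx^k at every
    point of the fibre. *)
Lemma dtan_vec_fst c (u : TM M) (w : E * E) : atlas c -> cdom c (base u) ->
  (dtan_vec c u w).1 = tan_vec c (base u) w.1.
Proof.
move=> ac cu.
have ou : (cmap c @` (cdom c `&` cdom (chart_at (base u)))) (Tcoord c u).1.
  by exists (base u) => //; split=> //; exact: chart_at_dom.
by have [_ ->] := tangent_transition_diff w ac (chart_at_atlas (base u)) ou.
Qed.

End ChangeOfChart.

(** * Smoothness near a point *)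

Section Smoothness.
Context {R : realType}.
Implicit Types (V W : normedModType R).

Lemma smooth_near_eq V W (f g : V -> W) x (B : set V) : open B -> B x ->
  (forall y, B y -> f y = g y) -> smooth_near f x -> smooth_near g x.
Proof.
move=> oB Bx fg [A [oA Ax sf]]; exists (A `&` B).
split=> [|//|k]; first exact: openI.
apply: (Ck_on_eq (f := f)) => [|y [_ By]|]; [exact: openI|exact: fg|].
by apply: Ck_on_sub (sf k) => y [].
Qed.

Lemma smooth_nearD V W (f g : V -> W) x :
  smooth_near f x -> smooth_near g x -> smooth_near (fun y => f y + g y) x.
Proof.
move=> [A [oA Ax sf]] [B [oB Bx sg]]; exists (A `&` B).
split=> [|//|k]; first exact: openI.
by apply: Ck_onD; [exact: openI|apply: Ck_on_sub (sf k) => y []|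
  apply: Ck_on_sub (sg k) => y []].
Qed.

Lemma smooth_near_cst V W (a : W) (x : V) : smooth_near (fun=> a) x.
Proof. by exists setT; split=> [||k]; [exact: openT|by []|exact: Ck_on_cst]. Qed.

Lemma smooth_near_coord V n (f : V -> 'rV[R]_n) x j :
  smooth_near f x -> smooth_near (fun y => f y 0 j) x.
Proof. by move=> [A [oA Ax sf]]; exists A; split=> // k; exact: Ck_on_coord. Qed.

Lemma smooth_nearZ V n (f : V -> R) (a : 'rV[R]_n) x :
  smooth_near f x -> smooth_near (fun y => f y *: a) x.
Proof.
move=> [A [oA Ax sf]]; exists A; split=> // k; apply: Ck_on_rV => // j.
apply: (Ck_on_eq (f := fun y => f y * a 0 j)) => // [y _|]; first by rewrite mxE.
by apply: Ck_onM => //; exact: Ck_on_cst.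
Qed.

Lemma smooth_near_fst V V' W (f : V -> W) (z : V * V') :
  smooth_near f z.1 -> smooth_near (f \o fst) z.
Proof.
have cfst : continuous (fst : V * V' -> V) by move=> y; exact: cvg_fst.
move=> [A [oA Az sf]]; exists (fst @^-1` A); split=> // [|k].
  by apply: open_comp => // y _; exact: cfst.
have H := @Ck_on_comp_affine _ k _ _ _ A f (fst : {linear (V * V')%type -> V}) 0 cfst (sf k).
have E : (fun x : V * V' => f (x.1 + 0)) = f \o fst.
  by apply/funext => x /=; rewrite addr0.
rewrite -E; apply: Ck_on_sub H => y /=; by rewrite addr0.
Qed.

(** A Finsler function is smooth near each point, possibly in a different
    chart for each; this assembles the local statements on a fibre. *)
Lemma Ck_on_local k V W (A : set V) (f : V -> W) :
  (forall x, A x -> exists2 B : set V, B x & Ck_on k B f) -> Ck_on k A f.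
Proof.
elim: k f => [|k IH] f H /=; first by move=> x /H[B Bx HB]; exact: HB.
split=> [x /H[B Bx [dB _]]|v]; first exact: dB.
by apply: IH => x /H[B Bx [_ HB]]; exists B => //; exact: HB.
Qed.

End Smoothness.

(** * A connection is determined by its values on a natural frame *)

Section Frames.
Context {R : realType} {n : nat} {M : manifold R n}.
Local Notation E := 'rV[R]_n.
Implicit Types (c : chart R n M) (p : M) (u : TM M).

Lemma chart_image_nbhs c p : cdom c p -> open (cmap c @` cdom c) /\
  (cmap c @` cdom c) (cmap c p).
Proof. by move=> cp; split; [exact: cimage_open|exists p]. Qed.

Lemma open_fst_preimage (A : set E) : open A -> open [set z : E * E | A z.1].
Proof.
move=> oA; apply: (@open_comp _ _ (fst : E * E -> E)) => // y _.
exact: cvg_fst.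
Qed.

Lemma coord_vfield_smooth c j p : atlas c -> cdom c p ->
  smooth_vfield_at (coord_vfield c j : vfield M) p.
Proof.
move=> ac cp; exists c; split=> //.
have [oI Ip] := chart_image_nbhs cp.
apply: (smooth_near_eq (f := fun=> delta_mx 0 j)) oI Ip _ _.
  move=> _ [p' cp' <-]; rewrite /local_vfield/= cmapK// /coord_vfield tan_vecK//.
exact: smooth_near_cst.
Qed.

Lemma pullback_smooth (Y : vfield M) u : smooth_vfield_at Y (base u) ->
  smooth_section_at (pullback_vfield Y) u.
Proof.
move=> [c [ac cu sY]]; exists c; split=> //.
exact: (@smooth_near_fst _ _ _ _ (local_vfield c Y) (Tcoord c u) sY).
Qed.

Definition smooth_in c (S : section M) u := smooth_near (local_section c S) (Tcoord c u).

Lemma smooth_inD c S S' u : smooth_in c S u -> smooth_in c S' u ->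
  smooth_in c (fun w => (S w : E) + S' w) u.
Proof.
move=> sS sS'; rewrite /smooth_in (_ : local_section _ _ =
  fun z => local_section c S z + local_section c S' z); first exact: smooth_nearD.
by apply/funext => z; rewrite /local_section /tan_coord linearD.
Qed.

Lemma smooth_in0 c u : smooth_in c (fun=> 0 : E) u.
Proof.
rewrite /smooth_in (_ : local_section _ _ = fun=> 0); first exact: smooth_near_cst.
by apply/funext => z; rewrite /local_section /tan_coord linear0.
Qed.

Lemma smooth_in_scale c (f : TM M -> R) j u : atlas c -> cdom c (base u) ->
  smooth_near (local_fun c f) (Tcoord c u) ->
  smooth_in c (fun w => f w *: (coord_vfield c j (base w) : E)) u.
Proof.
move=> ac cu sf; have [oI Iu] := chart_image_nbhs cu.
apply: (smooth_near_eq (f := fun z => local_fun c f z *: delta_mx 0 j))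
   (open_fst_preimage oI) _ _ _ => //; last exact: smooth_nearZ.
move=> z [p cp e]; rewrite /local_section /local_fun /= /tan_coord linearZ/=.
by congr (_ *: _); apply/esym; apply: tan_vecK => //; rewrite -e cmapK.
Qed.

Lemma connection_zero (D : connection M) u (V : dtangent u) : slit u ->
  D u V (fun=> 0 : E) = 0 :> E.
Proof.
move=> su; have s0 : smooth_section_at (fun=> 0 : E) u.
  exists (chart_at (base u)); split; [exact: chart_at_atlas|exact: chart_at_dom|].
  exact: smooth_in0.
have e0 : (fun w : TM M => 0 + 0 : E) = fun=> 0 by apply/funext => w; rewrite addr0.
have := nablaD D V su s0 s0; rewrite e0.
by rewrite -[X in X = _]addr0 => /addrI.
Qed.

(** Sections are total but smooth only near u, so S is not a combination of the
    frame.  Multiplying it by the indicator function chi of the chart domain,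
    which is smooth near u, makes it one; by the Leibniz rule chi S and S differ
    by the same term for both connections. *)
Lemma connection_eq_frame (D D' : connection M) c u (V : dtangent u)
    (S : section M) : atlas c -> cdom c (base u) -> slit u -> smooth_in c S u ->
  (forall j, D u V (pullback_vfield (coord_vfield c j)) =
             D' u V (pullback_vfield (coord_vfield c j))) ->
  D u V S = D' u V S.
Proof.
move=> ac cu su sS DD'; have [oI Iu] := chart_image_nbhs cu.
(* not continuous on TM, but locally constant near u *)
pose chi (w : TM M) : R := if `[< cdom c (base w) >] then 1 else 0.
pose f j (w : TM M) : R := chi w * (tan_coord c (S w) : E) 0 j.
have chi1 z : (cmap c @` cdom c) z.1 -> chi (Tpoint c z) = 1.
  move=> [p cp e]; rewrite /chi /= ifT//; apply/asboolP.
  by rewrite -e cmapK.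
have schi : smooth_near (local_fun c chi) (Tcoord c u).
  apply: (smooth_near_eq (f := fun=> (1 : R)) (open_fst_preimage oI)).
  - exact: Iu.
  - by move=> z /chi1; rewrite /local_fun/= => ->.
  - exact: smooth_near_cst.
have sf j : smooth_near (local_fun c (f j)) (Tcoord c u).
  apply: (smooth_near_eq (f := fun z => local_section c S z 0 j)
    (open_fst_preimage oI)); [exact: Iu| |exact: smooth_near_coord].
  by move=> z /chi1; rewrite /local_fun/= /f => ->; rewrite mul1r.
have chiS : (fun w => chi w *: (S w : E)) =
    (fun w => \sum_j f j w *: (coord_vfield c j (base w) : E)).
  apply/funext => w; rewrite /f /chi; case: asboolP => [cw|_].
    rewrite scale1r -{1}(tan_coordK (S w) ac cw) /coord_vfield.
    rewrite {1}(row_sum_delta (tan_coord c (S w))) /tan_vec linear_sum.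
    by apply: eq_bigr => j _; rewrite linearZ/= mul1r.
  by rewrite scale0r big1// => j _; rewrite mul0r scale0r.
have sec_at S' : smooth_in c S' u -> smooth_section_at S' u by exists c.
have fun_at g : smooth_near (local_fun c g) (Tcoord c u) -> smooth_fun_at g u.
  by exists c.
have spb j : smooth_section_at (pullback_vfield (coord_vfield c j)) u.
  by apply: pullback_smooth; exact: coord_vfield_smooth.
have term (D0 : connection M) j :
    D0 u V (fun w => f j w *: (coord_vfield c j (base w) : E)) =
    deriv_fun V (f j) *: (coord_vfield c j (base u) : E) +
    f j u *: (D0 u V (pullback_vfield (coord_vfield c j)) : E) :> E.
  exact: (nabla_leibniz D0 V su (fun_at _ (sf j)) (spb j)).
have sums (s : seq 'I_n) :
    smooth_in c (fun w => \sum_(j <- s) f j w *: (coord_vfield c j (base w) : E)) u /\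
    D u V (fun w => \sum_(j <- s) f j w *: (coord_vfield c j (base w) : E)) =
    D' u V (fun w => \sum_(j <- s) f j w *: (coord_vfield c j (base w) : E)).
  elim: s => [|j s [sms eqs]].
    have -> : (fun w : TM M => \sum_(j <- [::]) f j w *:
       (coord_vfield c j (base w) : E)) = fun=> 0.
      by apply/funext => w; rewrite big_nil.
    by split; [exact: smooth_in0|rewrite !connection_zero].
  have -> : (fun w : TM M => \sum_(k <- j :: s) f k w *:
       (coord_vfield c k (base w) : E)) = fun w =>
       f j w *: (coord_vfield c j (base w) : E) +
       \sum_(k <- s) f k w *: (coord_vfield c k (base w) : E).
    by apply/funext => w; rewrite big_cons.
  have smj := smooth_in_scale j ac cu (sf j).
  split; first exact: smooth_inD.
  have -> := nablaD D V su (sec_at _ smj) (sec_at _ sms).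
  have -> := nablaD D' V su (sec_at _ smj) (sec_at _ sms).
  by rewrite !term DD' eqs.
have chiE (D0 : connection M) : D0 u V (fun w => chi w *: (S w : E)) =
    deriv_fun V chi *: (S u : E) + D0 u V S :> E.
  have := nabla_leibniz D0 V su (fun_at _ schi) (sec_at _ sS).
  by rewrite {3}/chi ifT ?scale1r//; exact/asboolP.
have [_ eqn] := sums (index_enum 'I_n).
by apply: (addrI (deriv_fun V chi *: (S u : E))); rewrite -!chiE chiS.
Qed.

End Frames.

(** * Chern connections and pulled-back connections *)

Section Chern.
Context {R : realType} {n : nat} {M : manifold R n} (F : finsler M).
Local Notation E := 'rV[R]_n.
Implicit Types (c : chart R n M) (u : TM M).

(** Alternating the two symmetries three times returns to the same triple with
    the opposite sign. *)
Lemma cyclic_antisym_eq0 (I : Type) (T : I -> I -> I -> R) :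
  (forall i j k, T i j k = T i k j) -> (forall i j k, T i j k = - T j i k) ->
  forall i j k, T i j k = 0.
Proof.
move=> sym anti i j k.
have : T i j k = - T i j k.
  by rewrite {1}anti sym anti sym anti sym; lra.
lra.
Qed.

(** Subtracting the metric axiom for both connections and adding it to itself
    with i and j exchanged shows that the difference of the coefficients, with
    the upper index lowered by g + g^T, is antisymmetric in its first two
    indices; it is symmetric in the last two, so it vanishes, and g is definite. *)
Lemma chern_coef_unique (D D' : connection M) c u i j k :
  is_chern F D -> is_chern F D' -> atlas c -> cdom c (base u) -> slit u ->
  conn_coef D c u i j k = conn_coef D' c u i j k.
Proof.
move=> chD chD' ac cu su.
have [_ symD metD] := chD c u ac cu su.
have [_ symD' metD'] := chD' c u ac cu su.
set g := fund _ in metD metD'.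
pose Dl a b d := conn_coef D c u a b d - conn_coef D' c u a b d.
have eqn a b d : \sum_s g (Tcoord c u) s b * Dl s a d +
    \sum_s g (Tcoord c u) a s * Dl s b d = 0.
  have := metD a b (delta_mx 0 d, 0); rewrite -(metD' a b (delta_mx 0 d, 0)).
  have sumB (h : 'I_n -> R) q : \sum_s h s * Dl s q d =
    \sum_s h s * conn_form D c s q (dtan_vec c u (delta_mx 0 d, 0)) -
    \sum_s h s * conn_form D' c s q (dtan_vec c u (delta_mx 0 d, 0)).
    by rewrite -sumrB; apply: eq_bigr => s _; rewrite mulrBr.
  rewrite !sumB; lra.
pose G := fund (local_fun c F) (Tcoord c u).
pose T a b d := \sum_s (G s a + G a s) * Dl s b d.
have TE a b d : T a b d = \sum_s G s a * Dl s b d + \sum_s G a s * Dl s b d.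
  by rewrite /T -big_split; apply: eq_bigr => s _; rewrite mulrDl.
have T0 : forall a b d, T a b d = 0.
  apply: cyclic_antisym_eq0 => a b d.
    by apply: eq_bigr => s _; rewrite /Dl symD symD'.
  by have := eqn a b d; have := eqn b a d; rewrite !TE; lra.
pose v : E := \row_s Dl s j k.
have v0 : v = 0.
  apply: contrapT => /eqP v0.
  have := finsler_posdef F ac cu su v0; rewrite -/G.
  suff -> : (v *m G *m v^T) 0 0 = 2^-1 * \sum_a v 0 a * T a j k.
    by rewrite big1 ?mulr0 ?ltxx// => a _; rewrite T0 mulr0.
  have E1 : (v *m G *m v^T) 0 0 = \sum_a v 0 a * \sum_s G s a * Dl s j k.
    rewrite mxE; apply: eq_bigr => a _; rewrite !mxE mulrC; congr (_ * _).
    by apply: eq_bigr => s _; rewrite mxE mulrC.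
  have E2 : (v *m G *m v^T) 0 0 = \sum_a v 0 a * \sum_s G a s * Dl s j k.
    rewrite -mulmxA mxE; apply: eq_bigr => a _; rewrite !mxE; congr (_ * _).
    by apply: eq_bigr => s _; rewrite !mxE.
  under eq_bigr do rewrite TE mulrDr.
  by rewrite big_split/= -E1 -E2; lra.
by move/rowP: v0 => /(_ i); rewrite !mxE => /eqP; rewrite subr_eq0 => /eqP.
Qed.

Lemma chern_frame (D : connection M) c u (V : dtangent u) j :
  is_chern F D -> atlas c -> cdom c (base u) -> slit u ->
  D u V (pullback_vfield (coord_vfield c j)) =
  tan_vec c (base u) (\row_i \sum_k conn_coef D c u i j k *
    (@tan_coord _ _ M c (base u) V.1 : E) 0 k).
Proof.
move=> chD ac cu su; have [formD _ _] := chD c u ac cu su.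
rewrite -[LHS](tan_coordK _ ac cu); congr tan_vec; apply/rowP => i; rewrite mxE.
have := formD i j (dtan_coord c V); rewrite dtan_coordK// dtan_coord_fst//.
Qed.

(** A tangent vector is the horizontal lift of its base component plus a
    vertical vector, which a pulled-back connection ignores. *)
Lemma pullback_frame (A : affine_op) (P : connection M) u (V : dtangent u) Y :
  is_pullback F A P -> slit u -> smooth_vfield_at Y (base u) ->
  P u V (pullback_vfield Y) = A (base u) V.1 Y.
Proof.
move=> [Ph Pv] su sY; pose X : tangent (base u) := V.1.
pose W : dtangent u := (0, V.2 - (hlift F X).2).
have VE : V = (1 *: (hlift F X : E * E) + W : dtangent u).
  rewrite scale1r [LHS]surjective_pairing; congr pair; first by rewrite /= addr0.
  by rewrite /= addrC subrK.
rewrite {1}VE nabla_linear//; last exact: pullback_smooth.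
by rewrite scale1r Ph// Pv// addr0.
Qed.

Lemma pullback_chern_berwald (A : affine_op) (D P : connection M) :
  is_chern F D -> is_pullback F A P -> connection_eq P D -> berwald F.
Proof.
move=> chD PA PD D' chD' c p y y' ac cp sy sy' i j k.
have coefE (z : tangent p) : slit (Tvec z) -> conn_coef D' c (Tvec z) i j k =
    tan_coord c (A p (tan_vec c p (delta_mx 0 k)) (coord_vfield c j)) 0 i.
  move=> sz; rewrite (chern_coef_unique i j k chD' chD ac (cp : cdom c (base (Tvec z))) sz).
  have sf := coord_vfield_smooth j ac (cp : cdom c (base (Tvec z))).
  rewrite /conn_coef /conn_form -PD//; last exact: pullback_smooth.
  by rewrite (pullback_frame _ PA sz sf) dtan_vec_fst.
by rewrite !coefE.
Qed.

End Chern.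

(** * The averaged connection of a Berwald metric *)

Section Averaging.
Context {R : realType} {n : nat} {M : manifold R n} (F : finsler M).
Local Notation E := 'rV[R]_n.

(** Both bounds on the volume matter: fine sends oo to 0, and the inverse of 0
    is 0, so the average of a constant would otherwise be 0. *)
Lemma averaged_const (mu : M -> {measure set (@borel_rV R n) -> \bar R})
    (D : connection M) p (X : tangent p) (Y : vfield M) (C : E) :
  measurable (indicatrix F p : set (@borel_rV R n)) ->
  (0 < mu p (indicatrix F p) < +oo)%E ->
  (forall y : tangent p, indicatrix F p y ->
     D (Tvec y) (@hlift _ _ _ F (Tvec y) X) (pullback_vfield Y) = C :> E) ->
  averaged F mu D X Y = C.
Proof.
move=> mI /andP[v0 voo] DC; apply/rowP => i; rewrite /averaged !mxE.
have -> : (\int[mu p]_(y in indicatrix F p) (D (Tvec (y : tangent p))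
    (@hlift _ _ _ F (Tvec (y : tangent p)) X) (pullback_vfield Y) : E) 0 i)%R
    = (\int[mu p]_(y in indicatrix F p) C 0 i)%R.
  by apply: eq_Rintegral => y; rewrite inE => /DC ->.
rewrite Rintegral_cst// mulrC mulfK// gt_eqF// fine_gt0// v0//=.
Qed.

End Averaging.

Section IndicatrixVolume.
Context {R : realType} {m : nat} {M : manifold R m.+1} (F : finsler M) (p : M).
Local Notation E := 'rV[R]_m.+1.
Let l (y : E) : R := F (Tvec (y : tangent p)).

Lemma fibre_ge0 y : 0 <= l y.
Proof. exact: finsler_ge0. Qed.

Lemma fibre_homo (y : E) c : 0 < c -> l (c *: y) = c * l y.
Proof. exact: finsler_homo. Qed.

Lemma Tpoint_Tcoord (c : chart R m.+1 M) (y : tangent p) : atlas c -> cdom c p ->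
  Tpoint c (cmap c p, tan_coord c y) = Tvec y.
Proof.
move=> ac cp; rewrite /Tpoint/=.
have H q : q = p -> Tvec (tan_vec c q (tan_coord c y)) = Tvec y.
  by move=> ->; rewrite tan_coordK.
by apply: H; exact: cmapK.
Qed.

(** Smoothness of F is given in some chart around each point, but a change of
    chart is linear on the fibre, so it does not affect smoothness of l. *)
Lemma fibre_smooth : smooth_on [set y : E | y != 0] l.
Proof.
move=> k; apply: Ck_on_local => y y0.
have [c [ac cp [A [oA Ay sF]]]] := finsler_smooth F (y0 : slit (Tvec (y : tangent p))).
pose h (v : E) : E * E := (0, tan_coord c (v : tangent p)).
have hlin : linear h.
  by move=> a v w; rewrite /h /tan_coord linearP; congr pair; rewrite /= scaler0 addr0.
pose hM := GRing.isLinear.Build _ _ _ _ _ hlin.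
pose hL : {linear E -> (E * E)%type} := HB.pack h hM.
have ch : continuous hL by exact: linear_rV_continuous.
have hE v : hL v + (cmap c p, 0) = (cmap c p, tan_coord c (v : tangent p)).
  by rewrite /= /h; congr pair; rewrite /= ?add0r ?addr0.
have H := @Ck_on_comp_affine _ k _ _ _ A (local_fun c F) hL (cmap c p, 0) ch (sF k).
exists [set v | A (hL v + (cmap c p, 0))].
  by rewrite /= hE.
rewrite (_ : l = fun v => local_fun c F (hL v + (cmap c p, 0)))//.
by apply/funext => v; rewrite hE /local_fun/= Tpoint_Tcoord.
Qed.

(** Derivatives in vertical directions only see the restriction to the fibre. *)
Lemma fibre_metricE (y : E) : fibre_metric F p y = hess l y.
Proof.
rewrite /fibre_metric; set c := chart_at p.
have cp : cdom c p := chart_at_dom p.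
have zE (v : E) : Tcoord c (Tvec (v : tangent p)) = (cmap c p, v).
  by rewrite /Tcoord/= tan_coord_chart_at.
have LE (v : E) : local_fun c F (cmap c p, v) = l v.
  rewrite -[in LHS](tan_coord_chart_at (v : tangent p)) /local_fun/=.
  by rewrite Tpoint_Tcoord//; exact: chart_at_atlas.
(* both difference quotients are the same function of the increment *)
have vert (f : E * E -> R) (g : E -> R) j :
    (forall v, f (cmap c p, v) = g v) ->
    forall v, 'D_(dy j) f (cmap c p, v) = 'D_(delta_mx 0 j) g v.
  move=> fg v; rewrite /derive; set a := fun h : R => _; set b := fun h : R => _.
  suff -> : a = b by [].
  apply/funext => h; rewrite /a /b /= -!fg; congr (_ *: (f _ - _)).
  by congr pair; rewrite /= ?scaler0 ?add0r.
rewrite zE; apply/matrixP => i j; rewrite !mxE; congr (_ * _).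
by do 2 apply: (vert) => ?; rewrite LE.
Qed.

Lemma fibre_hess_pos (y : E) : y != 0 -> forall v : E, v != 0 ->
  0 < (v *m hess l y *m v^T) 0 0.
Proof.
move=> y0 v v0; rewrite -fibre_metricE.
exact: (@finsler_posdef _ _ _ F (chart_at p) (Tvec (y : tangent p))
  (chart_at_atlas p) (chart_at_dom p) y0 v v0).
Qed.

Lemma radial_regular i e : e = 1 \/ e = -1 ->
  regular_patch F p (@cube R m) (radial l i e).
Proof.
move=> e1; have e0 : e != 0 by case: e1 => ->; rewrite ?oppr_eq0 oner_eq0.
split.
- exact: open_cube.
- move=> k.
  by apply: Ck_on_sub (radial_smooth fibre_ge0 fibre_smooth fibre_homo
    fibre_hess_pos i e0 k).
- by move=> s t _ _; apply: (radial_inj fibre_ge0 fibre_smooth fibre_homo fibre_hess_pos e0).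
- by move=> t _ w; exact: (radial_immersion fibre_ge0 fibre_smooth fibre_homo fibre_hess_pos e0).
- move=> _ [t _ <-]; exact: (radial_norm fibre_ge0 fibre_smooth fibre_homo fibre_hess_pos i t e0).
Qed.

Lemma measurable_indicatrix :
  measurable (indicatrix F p : set (@borel_rV R m.+1)).
Proof. exact: (indicatrix_borel fibre_smooth fibre_homo). Qed.

Lemma indicatrix_volume (mu : {measure set (@borel_rV R m.+1) -> \bar R}) :
  is_indicatrix_volume F p mu -> (0 < mu (indicatrix F p) < +oo)%E.
Proof.
move=> [_ muE].
apply: (indicatrix_volume_bounds fibre_ge0 fibre_smooth fibre_homo fibre_hess_pos).
move=> i e e1; apply: (etrans (muE _ _ (radial_regular i e1))).
apply: (congr1 (@integral_rV R m)); apply/funext => t.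
suff gramE : gram F p (radial l i e) t = gram_radial l i e t by rewrite gramE.
by apply/matrixP => a b; rewrite [LHS]mxE [RHS]mxE fibre_metricE.
Qed.

End IndicatrixVolume.

Lemma berwald_averaged_frame (R : realType) m (M : manifold R m.+1)
    (F : finsler M) (D : connection M)
    (mu : M -> {measure set (@borel_rV R m.+1) -> \bar R})
    c u (V : dtangent u) j :
  berwald F -> is_chern F D -> (forall q, is_indicatrix_volume F q (mu q)) ->
  atlas c -> cdom c (base u) -> slit u ->
  averaged F mu D (V.1 : tangent (base u)) (coord_vfield c j) =
  D u V (pullback_vfield (coord_vfield c j)).
Proof.
case: u V => p y V; set u := Tvec y => bF chD muV ac cp su.
apply: averaged_const => [||z Iz].
- exact: measurable_indicatrix.
- exact: indicatrix_volume.
have sz : slit (Tvec z).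
  apply/eqP => z0; have l0 : F (Tvec (0 : tangent p)) = 0.
    exact: (minkowski_norm0 (fibre_homo F p)).
  move: Iz; rewrite /indicatrix/= [z](z0 : z = 0) l0 => /esym/eqP.
  by rewrite oner_eq0.
rewrite (chern_frame _ _ chD ac (cp : cdom c (base (Tvec z))) sz).
rewrite (chern_frame _ _ chD ac cp su).
apply: (congr1 (tan_vec c p)); apply/rowP => i; rewrite [LHS]mxE [RHS]mxE.
apply: eq_bigr => k _.
by have -> := bF D chD c p z y ac cp sz su i j k.
Qed.

Theorem proposition5p3p4 (R : realType) (n : nat) (M : manifold R n)
    (F : finsler M) (nabla_ch : connection M) (Hch : is_chern F nabla_ch)
    (dvol : M -> {measure set (@borel_rV R n) -> \bar R})
    (Hdvol : forall p : M, is_indicatrix_volume F p (dvol p))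
    (pi_avg : connection M)
    (Hpi : is_pullback F (averaged F dvol nabla_ch) pi_avg) :
  berwald F <-> connection_eq pi_avg nabla_ch.
Proof.
split; last exact: (pullback_chern_berwald Hch Hpi).
case: n => [|m] in M F nabla_ch Hch dvol Hdvol pi_avg Hpi *.
  move=> _ u V S su _; have : fib u != 0 :> 'rV[R]_0 by exact: su.
  by rewrite thinmx0 eqxx.
move=> bF u V S su [c [ac cu sS]].
apply: (connection_eq_frame ac cu su sS) => j.
rewrite (pullback_frame V Hpi su (coord_vfield_smooth j ac cu)).
exact: berwald_averaged_frame.
Qed.
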